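(* Let $j_0\in\mathbb{Q}$. There is an effectively computable constant $c(j_0)>0$, depending only on $j_0$, such that for every elliptic curve $E$ over $\mathbb{Q}$ with $j$-invariant equal to $j_0$ we have $$1+\mathrm{rank}\, E(\mathbb{Q})\ge c(j_0)\cdot \log \max\{\beta_x(E),\beta_y(E)\}.$$
   Context: For an elliptic curve $E$ over $\mathbb{Q}$, an $x$-arithmetic progression is a sequence $P_1,\dots,P_N$ of $\mathbb{Q}$-rational points on $E$ whose $x$-coordinates form an arithmetic progression for some choice of Weierstrass equation $y^2=x^3+ax^2+bx+c$ for $E$; a $y$-arithmetic progression is defined similarly with $y$-coordinates. Such a sequence is non-trivial if the resulting progression of coordinates is non-constant (these notions do not depend on the choice of Weierstrass equation). $\beta_x(E)$ (resp. $\beta_y(E)$) denotes the maximal length of a non-trivial $x$-arithmetic (resp. $y$-arithmetic) progression of rational points on $E$. ''Effectively computable'' means an explicit closed formula can be obtained. *)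

(* Defs.v *)
From HB Require Import structures.
From mathcomp Require Import all_boot all_order all_algebra.
From mathcomp Require Import all_classical all_reals all_analysis.
From mathcomp Require Import ring.

Set Implicit Arguments.
Unset Strict Implicit.
Unset Printing Implicit Defensive.

Import Order.TTheory GRing.Theory Num.Theory.

Local Open Scope classical_set_scope.
Local Open Scope ring_scope.

(* [disc] is the discriminant of the cubic x^3 + a x^2 + b x + c; the
   discriminant of the Weierstrass equation is 16 * disc, and its invariant
   c_4 is 16 (a^2 - 3 b). *)
Definition disc (a b c : rat) : rat :=
  a ^+ 2 * b ^+ 2 - 4 * b ^+ 3 - 4 * a ^+ 3 * c - 27 * c ^+ 2
  + 18 * a * b * c.

(* Over a field of characteristic 0 every elliptic curve has an equation
   y^2 = x^3 + a x^2 + b x + c. *)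
Record elliptic_curve := EllipticCurve {
  wa : rat;
  wb : rat;
  wc : rat;
  disc_neq0 : disc wa wb wc != 0 }.

Definition j_invariant (E : elliptic_curve) : rat :=
  (16 * (wa E ^+ 2 - 3 * wb E)) ^+ 3 / (16 * disc (wa E) (wb E) (wc E)).

(* [None] is the point at infinity. *)
Definition point := option (rat * rat).

Definition on_curve (E : elliptic_curve) (P : point) : bool :=
  if P is Some (x, y) then
    y ^+ 2 == x ^+ 3 + wa E * x ^+ 2 + wb E * x + wc E
  else true.

Definition negp (P : point) : point :=
  if P is Some (x, y) then Some (x, - y) else None.

Definition addp (E : elliptic_curve) (P Q : point) : point :=
  match P, Q with
  | None, _ => Q
  | _, None => P
  | Some (x1, y1), Some (x2, y2) =>
    if (x1 == x2) && (y1 == - y2) then None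
    else
      let l := if x1 == x2
               then (3 * x1 ^+ 2 + 2 * wa E * x1 + wb E) / (2 * y1)
               else (y2 - y1) / (x2 - x1) in
      let x3 := l ^+ 2 - wa E - x1 - x2 in
      Some (x3, l * (x1 - x3) - y1)
  end.

Lemma addp_on_curve (E : elliptic_curve) (P Q : point) :
  on_curve E P -> on_curve E Q -> on_curve E (addp E P Q).
Proof.
case: P Q => [[x1 y1]|] [[x2 y2]|] //= /eqP e1 /eqP e2.
case: ifPn => //.
have [ex|x12] := eqVneq x1 x2; last first.
  move=> _; have d0 : x2 - x1 != 0 by rewrite subr_eq0 eq_sym.
  set l := (y2 - y1) / (x2 - x1); apply/eqP.
  have el : y2 = y1 + l * (x2 - x1) by rewrite /l divfK // addrC subrK.
  apply: (mulfI d0); apply/eqP; rewrite -subr_eq0; apply/eqP.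
  have ec : wc E = y1 ^+ 2 - x1 ^+ 3 - wa E * x1 ^+ 2 - wb E * x1.
    by rewrite e1; ring.
  have eb : (x2 - x1) * wb E = y2 ^+ 2 - y1 ^+ 2 - (x2 ^+ 3 - x1 ^+ 3)
              - wa E * (x2 ^+ 2 - x1 ^+ 2).
    by rewrite e1 e2; ring.
  set x3 := l ^+ 2 - wa E - x1 - x2.
  transitivity ((x2 - x1) * ((l * (x1 - x3) - y1) ^+ 2
      - (x3 ^+ 3 + wa E * x3 ^+ 2
         + (y1 ^+ 2 - x1 ^+ 3 - wa E * x1 ^+ 2)))
      - (x2 - x1) * wb E * (x3 - x1)).
    by rewrite ec; ring.
  by rewrite eb el /x3; ring.
subst x2; rewrite /= -addr_eq0 => s0.
have /eqP : (y1 - y2) * (y1 + y2) = 0 by rewrite -subr_sqr e1 e2 subrr.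
rewrite mulf_eq0 (negPf s0) orbF subr_eq0 => /eqP ey; subst y2.
have d0 : 2 * y1 != 0 by rewrite mulr_natl mulr2n.
set l := _ / (2 * y1); apply/eqP.
have el : wb E = 2 * y1 * l - 3 * x1 ^+ 2 - 2 * wa E * x1.
  by rewrite /l mulrC divfK //; ring.
have ec : wc E = y1 ^+ 2 - x1 ^+ 3 - wa E * x1 ^+ 2 - wb E * x1.
  by rewrite e1; ring.
by rewrite ec el; ring.
Qed.

Definition mulp (E : elliptic_curve) (n : int) (P : point) : point :=
  match n with
  | Posz m => iter m (addp E P) None
  | Negz m => iter m.+1 (addp E (negp P)) None
  end.

Definition independent (E : elliptic_curve) (r : nat) (P : 'I_r -> point) :=
  forall k : 'I_r -> int,
    \big[addp E/None]_(i < r) mulp E (k i) (P i) = None ->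
    forall i, k i = 0.

(* The maximal number of Z-linearly independent points of E(Q), as an extended
   real: its finiteness is the Mordell-Weil theorem. *)
Definition mw_rank (R : realType) (E : elliptic_curve) : \bar R :=
  ereal_sup [set (r%:R)%:E | r in [set r : nat |
    exists2 P : 'I_r -> point,
      forall i, on_curve E (P i) & independent E P]].

(* The change of variables x = u^2 x' + r, y = u^3 y' turns the equation of E
   into that of E'. These are all the isomorphisms over Q between equations
   without xy and y terms. *)
Definition weierstrass_change (E E' : elliptic_curve) (u r : rat) : Prop :=
  [/\ u != 0,
      u ^+ 2 * wa E' = wa E + 3 * r,
      u ^+ 4 * wb E' = wb E + 2 * r * wa E + 3 * r ^+ 2
    & u ^+ 6 * wc E' = wc E + r * wb E + r ^+ 2 * wa E + r ^+ 3].

Definition change_point (u r : rat) (p : rat * rat) : rat * rat :=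
  ((p.1 - r) / u ^+ 2, p.2 / u ^+ 3).

Lemma change_point_on_curve (E E' : elliptic_curve) (u r : rat) p :
  weierstrass_change E E' u r ->
  on_curve E' (Some (change_point u r p)) = on_curve E (Some p).
Proof.
case: p => x y [u0 ea eb ec] /=.
set X := (x - r) / _; set Y := y / _.
have -> : x = u ^+ 2 * X + r by rewrite /X mulrC divfK ?expf_neq0 // subrK.
have -> : y = u ^+ 3 * Y by rewrite /Y mulrC divfK ?expf_neq0.
rewrite -[LHS](inj_eq (mulfI (expf_neq0 6 u0))) -subr_eq0 -[RHS]subr_eq0.
congr (_ == _).
have -> : wc E = u ^+ 6 * wc E' - r * wb E - r ^+ 2 * wa E - r ^+ 3.
  by rewrite ec; ring.
have -> : wb E = u ^+ 4 * wb E' - 2 * r * wa E - 3 * r ^+ 2 by rewrite eb; ring.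
have -> : wa E = u ^+ 2 * wa E' - 3 * r by rewrite ea; ring.
ring.
Qed.

Definition arith_prog (N : nat) (z : 'I_N -> rat) : Prop :=
  exists a d : rat, forall i : 'I_N, z i = a + (i : nat)%:R * d.

Definition nonconstant (N : nat) (z : 'I_N -> rat) : Prop :=
  exists i j : 'I_N, z i != z j.

(* [coord] is [fst] for x-arithmetic and [snd] for y-arithmetic progressions.
   Points having coordinates, all of them are affine. *)
Definition nontrivial_progression (coord : rat * rat -> rat)
    (E : elliptic_curve) (N : nat) (P : 'I_N -> rat * rat) : Prop :=
  (forall i, on_curve E (Some (P i))) /\
  exists (E' : elliptic_curve) (u r : rat),
    let z i := coord (change_point u r (P i)) in
    [/\ weierstrass_change E E' u r, arith_prog z & nonconstant z].

(* Taken in the extended reals, since the existence of a maximal length is not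
   known beforehand; the value is -oo if there is no progression at all. *)
Definition beta (R : realType) (coord : rat * rat -> rat)
    (E : elliptic_curve) : \bar R :=
  ereal_sup [set (N%:R)%:E | N in [set N : nat |
    exists P : 'I_N -> rat * rat, nontrivial_progression coord E P]].

Definition beta_x (R : realType) (E : elliptic_curve) : \bar R := beta R fst E.
Definition beta_y (R : realType) (E : elliptic_curve) : \bar R := beta R snd E.

(* Real-valued functions of a rational number given by an explicit closed
   formula in its numerator and denominator. Inverses and logarithms are only
   allowed where they are mathematically defined. *)
Inductive closed_formula (R : realType) : (rat -> R) -> Prop :=
| cf_const (q : rat) : closed_formula (fun=> ratr q)
| cf_num : closed_formula (fun t => (numq t)%:~R)
| cf_den : closed_formula (fun t => (denq t)%:~R)
| cf_opp f : closed_formula f -> closed_formula (fun t => - f t)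
| cf_add f g : closed_formula f -> closed_formula g ->
    closed_formula (fun t => f t + g t)
| cf_mul f g : closed_formula f -> closed_formula g ->
    closed_formula (fun t => f t * g t)
| cf_max f g : closed_formula f -> closed_formula g ->
    closed_formula (fun t => Num.max (f t) (g t))
| cf_inv f : closed_formula f -> (forall t, f t != 0) ->
    closed_formula (fun t => (f t)^-1)
| cf_exp f : closed_formula f -> closed_formula (fun t => expR (f t))
| cf_ln f : closed_formula f -> (forall t, 0 < f t) ->
    closed_formula (fun t => ln (f t)).

(* Main.v *)
(* Heights replace all the deep input. Let h be the logarithmic height of the
   twist-invariant coordinate of a point of E (x^3/q, x^2/p or x p/q on
   y^2 = x^3 + p x + q). With constants linear in 1 + h(j), one has
   h(P - Q) <= K (h(P) + h(Q)) + C and h(2P) >= 4 h(P) - C, the latter because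
   doubling acts on that coordinate by a map of degree 4 depending only on j.

   Packing: if points of height at most rho have differences of height at least
   eps rho, then their sums with weights 1, m, m^2, ... (m a large power of 2)
   are pairwise distinct; comparing their number with the number of possible
   coordinate vectors in Z^r shows that there are at most m^r such points. So a
   long progression, with rho its largest height, has many terms P + R_i with
   all R_i of height at most eps rho.

   Let P, P + R, P + S be three terms of an x-progression. Then
   k x(P + R) - (k - 1) x(P + S) = x(P) for some rational k, which is an equation
   in x(P) after elimination of y(P). It is monic up to scaling, because
   x(P + R) and x(P + S) stay bounded when P tends to infinity; hence
   h(P) << h(R) + h(S) + h(k) + h(j) + 1. Two terms determine the progression,
   so rho << eps rho + log N + h(j) + 1, that is rho << log N + h(j) + 1. But
   then the number of available R_i is at most a small power of N, whence
   log N << (1 + r) (1 + h(j)). For y-coordinates the argument is the same. *)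

Require Import Defs.
From HB Require Import structures.
From mathcomp Require Import all_boot all_order all_algebra.
From mathcomp Require Import all_classical all_reals all_analysis.
From mathcomp Require Import ring lra zify.

Set Implicit Arguments.
Unset Strict Implicit.
Unset Printing Implicit Defensive.

Import Order.TTheory GRing.Theory Num.Theory.

Local Open Scope ring_scope.

(** * The group law *)

(** The obstacle is uniformity in twists: all E with the same j must share one constant, so only
    twist-invariant quantities may enter the bounds, such as p/u^2, q/u^3 and the ratios u(P)/u(R),
    y(P)/y(R), where u is the abscissa on the depressed cubic. Dividing coordinates by those of R
    moves R to (1, 1) at the price of a factor d: the curve becomes d Y^2 = X^3 + p' X + q' with d =
    1 + p' + q'. The height used satisfies only a weak inequality for differences, with a large
    factor K. Packing tolerates this, because multiplication by a power of 2 multiplies heights by a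
    power of 4, which eventually beats any fixed K. The radius [delta] is a fixed fraction of the
    largest height [rho]. A ball of radius [delta] either has at most 10 points, or forces [rho] to
    be small; then [delta] is at most (log n + h)/7, or else O(h), with h = 1 + h(j). In all cases
    the ball contains at most sqrt(n) exp(O(h)) points. Hence n <= m^r sqrt(n) exp(O(h)), and the
    square root is absorbed on the left. The outcome is c(j0) = 1/(K (1 + h(j0))) with another,
    absolute K. *)

Section GroupLaw.
Variable E : elliptic_curve.
Implicit Types (P Q : Defs.point) (x y l : rat).

Definition opposite x1 y1 x2 y2 := (x1 == x2) && (y1 == - y2).

(* The line of slope [l] through both points meets the curve again in [x3]. *)
Definition chord x1 y1 x2 y2 l x3 :=
  [/\ y2 = y1 + l * (x2 - x1),
      wa E = l ^+ 2 - x1 - x2 - x3,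
      wb E = 2 * l * (y1 - l * x1) + x1 * x2 + x1 * x3 + x2 * x3
    & wc E = (y1 - l * x1) ^+ 2 - x1 * x2 * x3].

(** Since [chord] gives the coefficients of E as polynomials in x1, y1, x2, l, x3, it covers secants
    and tangents at once and turns identities of the group law into polynomial identities. *)
Lemma addp_chord x1 y1 x2 y2 l x3 :
  ~~ opposite x1 y1 x2 y2 -> chord x1 y1 x2 y2 l x3 ->
  addp E (Some (x1, y1)) (Some (x2, y2)) = Some (x3, l * (x1 - x3) - y1).
Proof.
rewrite /opposite /= => opp [e2 ea eb ec]; rewrite (negPf opp).
set l' := if _ then _ else _; suff -> : l' = l.
  by rewrite ea; congr (Some (_, _)); ring.
rewrite /l'; case: eqVneq opp => [ex | nx] /= opp.
  have y0 : 2 * y1 != 0.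
    move: opp; rewrite e2 ex subrr mulr0 addr0 -addr_eq0.
    by rewrite mulr_natl mulr2n.
  by apply: (mulIf y0); rewrite divfK // ea eb ex; ring.
have d0 : x2 - x1 != 0 by rewrite subr_eq0 eq_sym.
by apply: (mulIf d0); rewrite divfK // e2; ring.
Qed.

Lemma chordP x1 y1 x2 y2 :
  on_curve E (Some (x1, y1)) -> on_curve E (Some (x2, y2)) ->
  ~~ opposite x1 y1 x2 y2 -> exists l x3, chord x1 y1 x2 y2 l x3.
Proof.
rewrite /opposite => /= /eqP e1 /eqP e2.
have [ex|nx] /= := eqVneq x1 x2.
  subst x2; rewrite -addr_eq0 => s0.
  have /eqP : (y1 - y2) * (y1 + y2) = 0 by rewrite -subr_sqr e1 e2 subrr.
  rewrite mulf_eq0 (negPf s0) orbF subr_eq0 => /eqP ey; subst y2.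
  have d0 : 2 * y1 != 0 by rewrite mulr_natl mulr2n.
  set l := (3 * x1 ^+ 2 + 2 * wa E * x1 + wb E) / (2 * y1).
  exists l, (l ^+ 2 - wa E - x1 - x1).
  have el : wb E = 2 * y1 * l - 3 * x1 ^+ 2 - 2 * wa E * x1.
    by rewrite /l mulrC divfK //; ring.
  have ec : wc E = y1 ^+ 2 - x1 ^+ 3 - wa E * x1 ^+ 2 - wb E * x1.
    by rewrite e1; ring.
  by split; rewrite ?ec ?el; ring.
move=> _; have d0 : x2 - x1 != 0 by rewrite subr_eq0 eq_sym.
set l := (y2 - y1) / (x2 - x1).
have el : y2 = y1 + l * (x2 - x1) by rewrite /l divfK // addrC subrK.
have ec : wc E = y1 ^+ 2 - x1 ^+ 3 - wa E * x1 ^+ 2 - wb E * x1.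
  by rewrite e1; ring.
have eb : wb E = l * (y2 + y1) - (x2 ^+ 2 + x1 * x2 + x1 ^+ 2)
            - wa E * (x2 + x1).
  apply: (mulfI d0).
  transitivity (y2 ^+ 2 - y1 ^+ 2 - (x2 ^+ 3 - x1 ^+ 3)
              - wa E * (x2 ^+ 2 - x1 ^+ 2)); first by rewrite e1 e2; ring.
  by rewrite el; ring.
by exists l, (l ^+ 2 - wa E - x1 - x2); split; rewrite ?ec ?eb ?el; ring.
Qed.

Lemma addpC P Q : on_curve E P -> on_curve E Q -> addp E P Q = addp E Q P.
Proof.
case: P Q => [[x1 y1]|] [[x2 y2]|] // hP hQ.
have [opp|opp] := boolP (opposite x1 y1 x2 y2).
  have := opp; rewrite /addp /opposite => ->.
  by case/andP: opp => /eqP-> /eqP->; rewrite opprK !eqxx.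
have opp' : ~~ opposite x2 y2 x1 y1.
  by move: opp; rewrite /opposite (eq_sym x2) -!addr_eq0 addrC.
have [l [x3 c]] := chordP hP hQ opp.
rewrite (addp_chord opp c) (@addp_chord _ _ _ _ l x3) //.
  by case: c => -> _ _ _; congr (Some (_, _)); ring.
by case: c => e2 ea eb ec; split; rewrite ?ea ?eb ?ec ?e2; ring.
Qed.

Lemma negp_on_curve P : on_curve E (negp P) = on_curve E P.
Proof. by case: P => [[x y]|] //=; rewrite sqrrN. Qed.

Lemma negpK P : negp (negp P) = P.
Proof. by case: P => [[x y]|] //=; rewrite opprK. Qed.

Lemma addNp P : addp E (negp P) P = None.
Proof. by case: P => [[x y]|] //=; rewrite !eqxx. Qed.

Lemma negp_addp P Q : negp (addp E P Q) = addp E (negp P) (negp Q).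
Proof.
case: P Q => [[x1 y1]|] [[x2 y2]|] //=; rewrite eqr_opp.
case: ifP => // _; case: eqP => [_|_] /=; congr (Some (_, _)).
- by rewrite mulrN invrN mulrN sqrrN.
- by rewrite mulrN invrN mulrN sqrrN; ring.
- by rewrite -opprD mulNr sqrrN.
- by rewrite -opprD mulNr sqrrN; ring.
Qed.

(* If P + Q = -Q is a point of order 2, then the line through P and Q meets
   the curve twice in Q and has y = 0 there, so Q is singular. *)
Lemma addpK P Q : on_curve E P -> on_curve E Q ->
  addp E (addp E P Q) (negp Q) = P.
Proof.
case: P Q => [[x1 y1]|] [[x2 y2]|] // hP hQ; last first.
  by rewrite -[LHS](negpK) negp_addp negpK addNp.
have [opp|opp] := boolP (opposite x1 y1 x2 y2).
  have := opp; rewrite /addp /opposite => ->.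
  by case/andP: opp => /eqP-> /eqP->.
have [l [x3 c]] := chordP hP hQ opp.
rewrite (addp_chord opp c).
rewrite (@addp_chord _ _ _ _ (- l) x1); last by case: c => e2 ea eb ec; split; rewrite ?ea ?eb ?ec ?e2; ring.
  by congr (Some (_, _)); ring.
apply: contraNN (disc_neq0 E); case/andP; rewrite opprK => /eqP e3 /eqP ey.
case: c => e2 ea eb ec; have y20 : y2 = 0.
  by rewrite e3 in ey; lra.
have -> : disc (wa E) (wb E) (wc E) =
    disc (wa E) (wb E) (wc E) - 0 by rewrite subr0.
have e1 : y1 = - l * (x2 - x1) by rewrite -[y1](addrK (l * (x2 - x1))) -e2 y20; ring.
by rewrite /disc ea eb ec e1 e3; apply/eqP; ring.
Qed.

(* The parabola of leading coefficient [al] through the three points meets the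
   curve in a fourth point, which is -(P1 + P2 + P3). *)
Lemma addpA_generic x1 y1 x2 y2 x3 y3 l x12 l' x23 :
  x1 != x3 ->
  chord x1 y1 x2 y2 l x12 -> chord x2 y2 x3 y3 l' x23 ->
  ~~ opposite x12 (l * (x1 - x12) - y1) x3 y3 ->
  ~~ opposite x23 (l' * (x2 - x23) - y2) x1 y1 ->
  addp E (Some (x12, l * (x1 - x12) - y1)) (Some (x3, y3)) =
  addp E (Some (x23, l' * (x2 - x23) - y2)) (Some (x1, y1)).
Proof.
move=> n13 [e2 ea eb ec] [e3 ea' eb' ec'] opp opp'.
have d0 : x3 - x1 != 0 by rewrite subr_eq0 eq_sym.
pose al := (l' - l) / (x3 - x1).
have el : l' = l + al * (x3 - x1) by rewrite /al divfK // addrC subrK.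
(* The two chords give two expressions for [wa E] and for [wb E]. That these agree determines x12
   and x23 once multiplied by x3 - x1. *)
pose Da := (l ^+ 2 - x1 - x2 - x12) - (l' ^+ 2 - x2 - x3 - x23).
pose Db := (2 * l * (y1 - l * x1) + x1 * x2 + x1 * x12 + x2 * x12) -
  (2 * l' * (y2 - l' * x2) + x2 * x3 + x2 * x23 + x3 * x23).
have Da0 : Da = 0 by rewrite /Da -ea -ea' subrr.
have Db0 : Db = 0 by rewrite /Db -eb -eb' subrr.
have e12 : x12 = x3 - al * (y3 + y1 + l * (x3 - x1)).
  apply: (mulfI d0); apply/eqP; rewrite -subr_eq0; apply/eqP.
  transitivity (- (Da * x3 + Db + x2 * Da)).
    by rewrite /Da /Db ?e3 e2 el; ring.
  by rewrite Da0 Db0; ring.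
have e23 : x23 = x1 - al * (y1 + y2 + l' * (x1 - x2)).
  apply: (mulfI d0); apply/eqP; rewrite -subr_eq0; apply/eqP.
  transitivity (- (Da * x1 + Db + x2 * Da)).
    by rewrite /Da /Db ?e3 e2 el; ring.
  by rewrite Da0 Db0; ring.
(* For [al] = 0 the three points are collinear, so that P1 + P2 is opposite to P3. *)
have al0 : al != 0.
  apply: contra opp => /eqP al0; rewrite /opposite e12 e3 el al0 e2.
  by rewrite !(mul0r, addr0, subr0) eqxx; apply/eqP; ring.
(* By Vieta: the sum of the four roots of the quartic cut out by the parabola, minus x1 + x2 +
   x3. *)
pose X := al^-1 ^+ 2 - 2 * l / al + x1 + x2 - x3.
have c12 : chord x12 (l * (x1 - x12) - y1) x3 y3 (al^-1 - l) X.
  by split; rewrite ?ea ?eb ?ec /X ?e12 ?e3 ?el ?e2; field.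
have c23 : chord x23 (l' * (x2 - x23) - y2) x1 y1 (al^-1 - l') X.
  by split; rewrite ?ea' ?eb' ?ec' /X ?e23 ?e3 ?el ?e2; field.
rewrite (addp_chord opp c12) (addp_chord opp' c23).
by congr (Some (_, _)); rewrite /X e12 e23 e3 el e2; field.
Qed.

Lemma addp0 P : addp E P None = P.
Proof. by case: P => [[]|]. Qed.

Lemma opposite_addp x1 y1 x2 y2 :
  opposite x1 y1 x2 y2 = (addp E (Some (x1, y1)) (Some (x2, y2)) == None).
Proof. by rewrite /addp -/(opposite _ _ _ _); case: opposite. Qed.

Lemma addp_eq0 P Q : addp E P Q = None -> P = negp Q.
Proof.
case: P Q => [[x1 y1]|] [[x2 y2]|] //= /eqP; rewrite -opposite_addp.
by case/andP=> /eqP-> /eqP->.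
Qed.

Lemma addpA_nonzero P Q S : on_curve E P -> on_curve E Q -> on_curve E S ->
  addp E P Q != None -> addp E Q S != None ->
  P != S -> addp E P S != None ->
  addp E (addp E P Q) S != None -> addp E (addp E Q S) P != None ->
  addp E (addp E P Q) S = addp E (addp E Q S) P.
Proof.
case: P Q S => [[x1 y1]|] [[x2 y2]|] [[x3 y3]|] h1 h2 h3 n12 n23 n13 m13;
  rewrite ?addp0 //; last first.
- by move=> _ _; apply: addpC.
- by move=> _ _; rewrite addpC.
have d13 : x1 != x3.
  move: m13; rewrite -opposite_addp /opposite; case: eqVneq => //= e13.
  subst x3; rewrite -addr_eq0 => s0.
  have /eqP : (y1 - y3) * (y1 + y3) = 0.
    by move: h1 h3 => /= /eqP h1 /eqP h3; rewrite -subr_sqr h1 h3 subrr.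
  by rewrite mulf_eq0 (negPf s0) orbF subr_eq0 => /eqP e; rewrite e eqxx in n13.
have o12 : ~~ opposite x1 y1 x2 y2 by rewrite opposite_addp.
have o23 : ~~ opposite x2 y2 x3 y3 by rewrite opposite_addp.
have [l [x12 c]] := chordP h1 h2 o12; have [l' [x23 c']] := chordP h2 h3 o23.
rewrite (addp_chord o12 c) (addp_chord o23 c') => N1 N2.
by apply: (addpA_generic d13 c c'); rewrite opposite_addp.
Qed.

End GroupLaw.

(** * Associativity from its generic case *)

Section AbstractAssociativity.
Variables (T : Type) (add : T -> T -> T) (neg : T -> T) (o : T).
Hypothesis addC : commutative add.
Hypothesis add0 : left_id o add.
Hypothesis negK : involutive neg.
Hypothesis addN : left_inverse o neg add.
Hypothesis add_eq0 : forall P Q, add P Q = o -> P = neg Q.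
Hypothesis neg_add : {morph neg : P Q / add P Q}.
Hypothesis addK : forall P Q, add (add P Q) (neg Q) = P.
Hypothesis addA_nonzero : forall P Q S,
  add P Q <> o -> add Q S <> o -> P <> S -> add P S <> o ->
  add (add P Q) S <> o -> add (add Q S) P <> o ->
  add (add P Q) S = add (add Q S) P.

(** Each degenerate case has a vanishing partial sum or P = S. The latter is commutativity; the
    others follow from the cancellation law [addK], which also lets a vanishing triple sum be
    rotated ([rot]). *)
Lemma associative_of_generic : associative add.
Proof.
have subK P Q : add (add P (neg Q)) Q = P by rewrite -{2}[Q]negK addK.
have rot P Q S : add (add P Q) S = o -> add Q S = neg P.
  move=> e; have -> : S = neg (add P Q) by rewrite (add_eq0 e) negK.
  by rewrite -[LHS]negK neg_add negK addC addK.
move=> P Q S.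
have [PQ|PQ] := pselect (add P Q = o).
  by rewrite PQ add0 (add_eq0 PQ) addC (addC (Q)) addK.
have [QS|QS] := pselect (add Q S = o).
  by rewrite QS addC add0 (add_eq0 QS) subK.
have [->|PS] := pselect (P = S); first by rewrite addC (addC Q).
have [PS0|PS0] := pselect (add P S = o).
  by rewrite (add_eq0 PS0) addC addK (addC _ Q) subK.
have [e|n1] := pselect (add (add P Q) S = o).
  by rewrite (rot _ _ _ e) e addC addN.
have [e|n2] := pselect (add (add Q S) P = o).
  by rewrite addC e (addC P) (rot S Q P) ?addN // (addC S).
by rewrite addC; apply/esym/addA_nonzero.
Qed.
End AbstractAssociativity.

Section CurveGroup.
Variable E : elliptic_curve.

(** The laws of [addp] are established for points on the curve, so the group structure lives on this
    subtype. *)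
Definition curve_pt := {P : Defs.point | on_curve E P}.
HB.instance Definition _ := Choice.on curve_pt.

Implicit Types P Q S : curve_pt.

Definition cadd P Q : curve_pt :=
  exist _ (addp E (val P) (val Q)) (addp_on_curve (valP P) (valP Q)).

Definition copp P : curve_pt :=
  exist _ (negp (val P)) (etrans (negp_on_curve E (val P)) (valP P)).

Definition czero : curve_pt := exist _ None isT.

Lemma val_cadd P Q : val (cadd P Q) = addp E (val P) (val Q).
Proof. by []. Qed.

Lemma val_copp P : val (copp P) = negp (val P).
Proof. by []. Qed.

Lemma caddC : commutative cadd.
Proof. by move=> P Q; apply: val_inj; rewrite !val_cadd addpC // (valP P, valP Q). Qed.

Lemma cadd0 : left_id czero cadd.
Proof. by move=> P; apply: val_inj. Qed.

Lemma caddN : left_inverse czero copp cadd.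
Proof. by move=> P; apply: val_inj; rewrite val_cadd addNp. Qed.

Lemma caddA : associative cadd.
Proof.
apply: (@associative_of_generic _ cadd copp czero caddC cadd0 _ caddN).
- by move=> P; apply: val_inj; rewrite !val_copp negpK.
- by move=> P Q e; apply: val_inj; apply: (@addp_eq0 E); rewrite -val_cadd e.
- by move=> P Q; apply: val_inj; rewrite !(val_cadd, val_copp) negp_addp.
- move=> P Q; apply: val_inj; rewrite !(val_cadd, val_copp).
  by rewrite addpK // (valP P, valP Q).
move=> P Q S n1 n2 n3 n4 n5 n6; apply: val_inj; rewrite !val_cadd.
have nz A : A <> czero -> val A != None.
  by move=> nA; apply/eqP => e; apply: nA; apply: val_inj.
apply: addpA_nonzero; rewrite ?(valP P) ?(valP Q) ?(valP S) //.
- exact: nz n1.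
- exact: nz n2.
- by apply/eqP => e; apply: n3; apply: val_inj.
- exact: nz n4.
- exact: nz n5.
- exact: nz n6.
Qed.

HB.instance Definition _ :=
  GRing.isZmodule.Build curve_pt caddA caddC cadd0 caddN.

Lemma val_curveD P Q : val (P + Q) = addp E (val P) (val Q).
Proof. by []. Qed.

Lemma val_curveN P : val (- P) = negp (val P).
Proof. by []. Qed.

Lemma val_curve_mulz P (n : int) : val (P *~ n) = mulp E n (val P).
Proof.
have mulrnE (A : curve_pt) m : val (A *+ m) = iter m (addp E (val A)) None.
  by elim: m => [|m IH]; rewrite ?mulr0n // mulrS iterS -IH.
case: n => m; first by rewrite -pmulrn mulrnE.
by rewrite NegzE mulrNz -mulNrz -pmulrn mulrnE val_curveN.
Qed.

Lemma val_curve_sum r (F : 'I_r -> curve_pt) :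
  val (\sum_(i < r) F i) = \big[addp E/None]_(i < r) val (F i).
Proof. by elim/big_ind2: _ => // x1 P x2 Q <- <-; rewrite val_curveD. Qed.

End CurveGroup.

(** * Heights of rational numbers *)

Section Height.
Variable R : realType.
Implicit Types (x y : rat).

Definition mheight x : nat := maxn `|numq x| `|denq x|.
Definition height x : R := ln (mheight x)%:R.

Lemma mheight_gt0 x : (0 < mheight x)%N.
Proof. by rewrite leq_max !absz_gt0 denq_neq0 orbT. Qed.

Lemma mheight_frac_le (n d : int) :
  d != 0 -> (mheight (n%:~R / d%:~R) <= maxn `|n| `|d|)%N.
Proof.
case: divqP => // k x k0 _; rewrite /mheight !abszM -maxnMr.
by apply: leq_pmull; rewrite absz_gt0.
Qed.

Lemma mheight_frac (n d : int) : d != 0 -> coprime `|n| `|d| ->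
  mheight (n%:~R / d%:~R) = maxn `|n| `|d|.
Proof.
move=> d0 cop; rewrite /mheight coprimeq_num // coprimeq_den // (negPf d0).
by rewrite abszM absz_sg d0 mul1n.
Qed.

Lemma mheightM x y : (mheight (x * y) <= mheight x * mheight y)%N.
Proof.
rewrite -{1}(divq_num_den x) -{1}(divq_num_den y) mulf_div -!rmorphM.
apply: leq_trans (mheight_frac_le _ _) _; first by rewrite mulf_neq0 ?denq_neq0.
by rewrite !abszM geq_max !leq_mul ?leq_maxl ?leq_maxr.
Qed.

Lemma mheightD x y : (mheight (x + y) <= 2 * (mheight x * mheight y))%N.
Proof.
rewrite -{1}(divq_num_den x) -{1}(divq_num_den y) addf_div ?intr_eq0 ?denq_neq0 //.
rewrite -!rmorphM -rmorphD.
apply: leq_trans (mheight_frac_le _ _) _; first by rewrite mulf_neq0 ?denq_neq0.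
have leN (n1 n2 d1 d2 : int) : (absz (n1 * d2)%R <= maxn `|n1| `|d1| * maxn `|n2| `|d2|)%N.
  by rewrite abszM leq_mul ?leq_maxl ?leq_maxr.
rewrite geq_max; apply/andP; split; last first.
 rewrite abszM (leq_trans _ (leq_pmull _ _)) //.
  by rewrite leq_mul // leq_maxr.
have tri (a b : int) : (absz (a + b)%R <= `|a| + `|b|)%N by lia.
apply: leq_trans (tri _ _) _; rewrite mul2n -addnn leq_add //.
  exact: leN.
by rewrite mulnC; apply: leN.
Qed.

Lemma mheightV x : mheight x^-1 = mheight x.
Proof.
have [->|x0] := eqVneq x 0; first by rewrite invr0.
rewrite -{1}(divq_num_den x) invf_div mheight_frac ?numq_eq0 //.
  by rewrite maxnC.
by rewrite coprime_sym coprime_num_den.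
Qed.

Lemma mheightX x n : mheight (x ^+ n) = (mheight x ^ n)%N.
Proof.
have absX (m : int) : absz (m ^+ n)%R = (absz m ^ n)%N by rewrite abszX.
have cop : coprime (absz (numq x ^+ n)) (absz (denq x ^+ n)).
  by rewrite !absX; case: n {absX} => // n; rewrite coprime_pexpl // coprime_pexpr // coprime_num_den.
have {1}-> : x ^+ n = (numq x ^+ n)%:~R / (denq x ^+ n)%:~R.
  by rewrite !rmorphXn /= -expr_div_n divq_num_den.
rewrite mheight_frac ?expf_neq0 ?denq_neq0 //.
have le_exp (a b : nat) : (a <= b -> a ^ n <= b ^ n)%N.
  by case: n {absX cop} => // n; rewrite leq_exp2r.
rewrite !absX /mheight; case: (leqP `|numq x| `|denq x|) => h.
  by rewrite (maxn_idPr _) // le_exp.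
by rewrite (maxn_idPl _) // le_exp // ltnW.
Qed.

Lemma height_ge0 x : 0 <= height x.
Proof. by rewrite ln_ge0 // ler1n mheight_gt0. Qed.

Lemma mheight_pos x : (mheight x)%:R \is @Num.pos R.
Proof. by rewrite posrE ltr0n mheight_gt0. Qed.

Lemma height_le x (n : nat) : (mheight x <= n)%N -> height x <= ln n%:R.
Proof.
move=> h; rewrite ler_ln ?posrE ?ler_nat ?ltr0n ?mheight_gt0 //.
exact: leq_trans (mheight_gt0 x) h.
Qed.

Lemma heightM x y : height (x * y) <= height x + height y.
Proof.
rewrite -lnM ?mheight_pos // -natrM; exact: height_le (mheightM x y).
Qed.

Lemma ln2_le1 : ln 2 <= 1 :> R.
Proof. by apply: (@le_ln1Dx R 1); apply: lt_trans ltr01; rewrite ltrN10. Qed.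

Lemma heightD x y : height (x + y) <= height x + height y + 1.
Proof.
apply: le_trans (height_le (mheightD x y)) _.
rewrite !natrM lnM ?lnM ?posrE ?mulr_gt0 ?ltr0n ?mheight_gt0 //.
by rewrite -!/(height _); have := ln2_le1; lra.
Qed.

Lemma heightN x : height (- x) = height x.
Proof. by rewrite /height /mheight numqN denqN abszN. Qed.

Lemma heightB x y : height (x - y) <= height x + height y + 1.
Proof. by rewrite -(heightN y) heightD. Qed.

Lemma heightV x : height x^-1 = height x.
Proof. by rewrite /height mheightV. Qed.

Lemma heightF x y : height (x / y) <= height x + height y.
Proof. by rewrite -(heightV y) heightM. Qed.

Lemma heightX x n : height (x ^+ n) = n%:R * height x.
Proof. by rewrite /height mheightX natrX lnXn ?ltr0n ?mheight_gt0 // mulr_natl. Qed.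

Lemma height_int (n : int) : height n%:~R = ln (maxn `|n| 1)%:R.
Proof. by rewrite /height /mheight numq_int denq_int. Qed.

Lemma height0 : height 0 = 0.
Proof. by rewrite (height_int 0) ln1. Qed.

Lemma height1 : height 1 = 0.
Proof. by rewrite (height_int 1) ln1. Qed.

Lemma height_nat n : height n%:R <= n%:R.
Proof.
case: n => [|n]; first by rewrite height0.
rewrite (height_int n.+1) /= (maxn_idPl _) //.
by apply/ltW/ln_sublinear; rewrite ltr0n.
Qed.

Lemma monic_hornerE (p : {poly rat}) x : p \is monic ->
  p.[x] = \sum_(i < (size p).-1) p`_i * x ^+ i + x ^+ (size p).-1.
Proof.
move=> mon; have szp : size p = (size p).-1.+1.
  by rewrite prednK // size_poly_gt0 monic_neq0.
rewrite horner_coef szp big_ord_recr /=; congr (_ + _).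
by move/monicP: mon; rewrite lead_coefE => ->; rewrite mul1r.
Qed.

(** Multiplying p by the product D of these denominators gives an integral polynomial with leading
    coefficient D. As in the rational root theorem, [denq x] divides D times a power of [numq x], to
    which it is coprime. *)
Lemma monic_root_denq_dvd (p : {poly rat}) x : p \is monic -> root p x ->
  (denq x %| \prod_(i < (size p).-1) denq p`_i)%Z.
Proof.
set n := (size p).-1; set D := \prod_(i < n) _ => mon /rootP r0.
have [c cE] : exists c : 'I_n -> int, forall i, (c i)%:~R = D%:~R * p`_i.
  exists (fun i : 'I_n => numq p`_i * \prod_(j < n | j != i) denq p`_j) => i.
  have aux (a b w : rat) : b != 0 -> a * w = b * w * (a / b) by move=> b0; field.
  have -> : D = denq p`_i * \prod_(j < n | j != i) denq p`_j by rewrite /D (bigD1 i).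
  rewrite !intrM -{3}(divq_num_den p`_i).
  by apply: aux; rewrite intr_eq0 denq_neq0.
have pE : x ^+ n = - \sum_(i < n) p`_i * x ^+ i.
  by apply/eqP; rewrite -addr_eq0 addrC -monic_hornerE // r0.
have E : D * numq x ^+ n =
    denq x * (- \sum_(i < n) c i * numq x ^+ i * denq x ^+ (n - i.+1)).
  apply: (@intr_inj rat); rewrite !intrM !rmorphXn rmorphN rmorph_sum /=.
  rewrite numqE (_ : (x * _) ^+ n = x ^+ n * (denq x)%:~R ^+ n); last exact: exprMn.
  rewrite pE mulNr !mulrN mulr_suml !mulr_sumr; congr (- _).
  apply: eq_bigr => i _.
  rewrite !intrM !rmorphXn /= numqE cE.
  rewrite (_ : (x * _) ^+ i = x ^+ i * (denq x)%:~R ^+ i); last exact: exprMn.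
  have -> : (denq x)%:~R ^+ n = (denq x)%:~R * (denq x)%:~R ^+ i
      * (denq x)%:~R ^+ (n - i.+1) :> rat.
    by rewrite -exprS -exprD subnKC.
  by ring.
have : (denq x %| D * numq x ^+ n)%Z by rewrite E dvdz_mulr.
rewrite Gauss_dvdzl // /coprimez /gcdz /=; apply/eqP; congr Posz.
apply/eqP; rewrite abszX -/(coprime _ _).
by apply: coprimeXr; rewrite coprime_sym coprime_num_den.
Qed.

Lemma le_1Dsum_prod (I : Type) (s : seq I) (F : I -> rat) :
  (forall i, 0 <= F i) -> 1 + \sum_(i <- s) F i <= \prod_(i <- s) (1 + F i).
Proof.
move=> F0; elim: s => [|i s IH]; first by rewrite !big_nil addr0.
rewrite !big_cons mulrDl mul1r.
have S0 : 0 <= \sum_(j <- s) F j by apply: sumr_ge0.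
apply: le_trans (_ : _ <= (1 + \sum_(j <- s) F j) + F i * (1 + \sum_(j <- s) F j)) _.
  have := mulr_ge0 (F0 i) S0; have := F0 i; lra.
by rewrite lerD // ler_wpM2l.
Qed.

(** Cauchy's bound: when |x| > 1, all lower powers of x are at most |x|^(n-1) in absolute value, by
    which the equation is divided. *)
Lemma monic_root_norm (p : {poly rat}) x : p \is monic -> root p x ->
  `|x| <= 1 + \sum_(i < (size p).-1) `|p`_i|.
Proof.
set n := (size p).-1 => mon /rootP r0.
have S0 : 0 <= \sum_(i < n) `|p`_i| by apply: sumr_ge0.
have [x1|x1] := leP `|x| 1; first by lra.
have pE : x ^+ n = - \sum_(i < n) p`_i * x ^+ i.
  by apply/eqP; rewrite -addr_eq0 addrC -monic_hornerE // r0.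
case: n S0 pE => [|n] S0 pE.
  by move/eqP: pE; rewrite big_ord0 oppr0 oner_eq0.
suff : `|x| <= \sum_(i < n.+1) `|p`_i| by lra.
have xn0 : 0 < `|x| ^+ n by rewrite exprn_gt0 //; lra.
rewrite -(ler_pM2r xn0) -exprS -normrX pE normrN.
apply: le_trans (ler_norm_sum _ _ _) _; rewrite mulr_suml ler_sum // => i _.
rewrite normrM normrX ler_wpM2l // ler_weXn2l //; first by lra.
by rewrite -ltnS.
Qed.

Lemma height_prod_le (n : nat) (F : 'I_n -> rat) x :
  (mheight x <= \prod_(i < n) (2 * mheight (F i)))%N ->
  height x <= \sum_(i < n) (height (F i) + 1).
Proof.
move=> le; apply: le_trans (height_le le) _.
elim: n F {le} => [|n IH] F; first by rewrite !big_ord0 ln1.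
rewrite !big_ord_recr /= natrM lnM ?posrE ?ltr0n ?prodn_gt0 //; last 2 first.
- by move=> i; rewrite muln_gt0 mheight_gt0.
- by rewrite muln_gt0 mheight_gt0.
rewrite lerD //.
rewrite natrM lnM ?posrE ?ltr0n ?mheight_gt0 // -/(height _).
by have := ln2_le1; lra.
Qed.

(** With D the product of the denominators, numerator and denominator of x are at most D (1 + sum
    |p_i|), hence at most the product of the denq p_i + |numq p_i|. Each factor is at most twice the
    height of p_i, and ln 2 <= 1. *)
Lemma height_monic_root (p : {poly rat}) x : p \is monic -> root p x ->
  height x <= \sum_(i < (size p).-1) (height p`_i + 1).
Proof.
move=> mon r0; apply: height_prod_le.
have hden := monic_root_denq_dvd mon r0; have hnorm := monic_root_norm mon r0.
set n := (size p).-1 in hden hnorm *; set D := \prod_(i < n) _ in hden.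
have D0 : 0 < D by apply: prodr_gt0.
have denD : (denq x)%:~R <= D%:~R :> rat.
  have /dvdn_leq : (`|denq x| %| `|D|)%N by [].
  have := denq_gt0 x; rewrite ler_int; lia.
have S0 : 0 <= \sum_(i < n) `|p`_i| by apply: sumr_ge0.
have d0 : 0 < (denq x)%:~R :> rat by rewrite ltr0z.
have key : D%:~R * (1 + \sum_(i < n) `|p`_i|) <=
    (\prod_(i < n) (2 * mheight p`_i))%N%:R :> rat.
  apply: le_trans (_ : _ <= D%:~R * \prod_(i < n) (1 + `|p`_i|)) _.
    by rewrite ler_pM2l ?ltr0z // le_1Dsum_prod.
  rewrite /D rmorph_prod /= -big_split /= natr_prod ler_prod // => i _.
  have di0 : 0 < (denq p`_i)%:~R :> rat by rewrite ltr0z.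
  rewrite mulr_ge0 ?addr_ge0 // ?(ltW di0) //= mulrDr mulr1.
  rewrite -[X in X * `|_|](gtr0_norm di0) -normrM mulrC -numqE natrM mulr_natl mulr2n.
  rewrite -normr_denq -natr_absz -intr_norm -natr_absz lerD // ler_nat.
    exact: leq_maxr.
  exact: leq_maxl.
have le_nat (m : int) (k : nat) : `|m%:~R| <= k%:R :> rat -> (absz m <= k)%N.
  by rewrite -intr_norm -natr_absz ler_nat.
rewrite /mheight geq_max; apply/andP; split; apply: le_nat; apply: le_trans key.
  rewrite numqE normrM (gtr0_norm d0) mulrC.
  by apply: ler_pM => //; apply: ltW.
rewrite (gtr0_norm d0); apply: le_trans denD _.
by rewrite ler_peMr ?lerDl // ler0z ltW.
Qed.

End Height.

(** * Three terms of a progression *)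

Section PolynomialHeight.
Variable R : realType.
Implicit Types (p q : {poly rat}) (x : rat).
Local Notation height := (height R).

(** Coefficients are bounded one by one, not as a projective point, because [height_monic_root] adds
    up their separate heights. *)
Definition pbound n (B : R) p :=
  (size p <= n)%N /\ forall i, height p`_i <= B.

Lemma pbound_ge0 n B p : pbound n B p -> 0 <= B.
Proof. by case=> _ /(_ 0%N); apply: le_trans; apply: height_ge0. Qed.

Lemma pbound_le n B p n' B' :
  (n <= n')%N -> B <= B' -> pbound n B p -> pbound n' B' p.
Proof.
move=> nn' BB' [sp hp]; split; first exact: leq_trans nn'.
by move=> i; apply: le_trans BB'.
Qed.

Lemma pboundC c : pbound 1 (height c) c%:P.
Proof.
split; first exact: size_polyC_leq1.
by move=> i; rewrite coefC; case: eqP => // _; rewrite height0 height_ge0.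
Qed.

Lemma pboundX : pbound 2 0 'X.
Proof.
split; first by rewrite size_polyX.
by move=> i; rewrite coefX; case: eqP => _; rewrite ?height1 ?height0.
Qed.

Lemma pboundXsubC c : pbound 2 (height c) ('X - c%:P).
Proof.
split; first by rewrite size_XsubC.
move=> i; rewrite coefB coefX coefC; case: i => [|[|i]] /=.
- by rewrite sub0r heightN.
- by rewrite subr0 height1 height_ge0.
- by rewrite subr0 height0 height_ge0.
Qed.

Lemma pbound_Poly s B :
  0 <= B -> (forall x, x \in s -> height x <= B) -> pbound (size s) B (Poly s).
Proof.
move=> B0 sB; split; first exact: size_Poly.
move=> i; rewrite coef_Poly; have [si|si] := leqP (size s) i.
  by rewrite nth_default // height0.
by apply: sB; apply: mem_nth.
Qed.

Lemma pboundN n B p : pbound n B p -> pbound n B (- p).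
Proof. by case=> sp hp; split=> [|i]; rewrite ?size_polyN // coefN heightN. Qed.

Lemma pboundD n m B B' p q :
  pbound n B p -> pbound m B' q -> pbound (maxn n m) (B + B' + 1) (p + q).
Proof.
move=> [sp hp] [sq hq]; split.
  apply: leq_trans (size_polyD _ _) _; rewrite geq_max !leq_max sp sq orbT //.
move=> i; rewrite coefD; apply: le_trans (heightD _ _ _) _.
by have := hp i; have := hq i; lra.
Qed.

Lemma pboundB n m B B' p q :
  pbound n B p -> pbound m B' q -> pbound (maxn n m) (B + B' + 1) (p - q).
Proof. by move=> hp /pboundN; apply: pboundD. Qed.

Lemma height_sum n (F : 'I_n -> rat) B : (forall i, height (F i) <= B) ->
  height (\sum_(i < n) F i) <= n%:R * (B + 1).
Proof.
move=> hF; elim: n F hF => [|n IH] F hF; first by rewrite big_ord0 height0 mul0r.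
rewrite big_ord_recr /=; apply: le_trans (heightD _ _ _) _.
have := IH (fun i => F (widen_ord (leqnSn n) i)) (fun i => hF _).
by have := hF ord_max; rewrite -natr1 /=; lra.
Qed.

(** A coefficient of the product is a sum of at most n terms, each costing one more unit in
    [heightD]. Only the size of the left factor counts, so constants are best written on the
    left. *)
Lemma pboundM n m B B' p q : pbound n B p -> pbound m B' q ->
  pbound (n + m).-1 (n%:R * (B + B' + 1)) (p * q).
Proof.
move=> hp' hq'; have B0 := pbound_ge0 hp'; have B0' := pbound_ge0 hq'.
case: hp' hq' => [sp hp] [sq hq]; split.
  apply: leq_trans (size_polyMleq _ _) _.
  by rewrite -!subn1 leq_sub2r // leq_add.
have -> : p = \sum_(j < n) p`_j *: 'X^j.
  rewrite -poly_def; apply/polyP => i; rewrite coef_poly.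
  by case: ltnP => // ni; rewrite nth_default // (leq_trans sp).
move=> i; rewrite mulr_suml coef_sum; apply: height_sum => j.
rewrite -scalerAl coefZ coefXnM; apply: le_trans (heightM _ _ _) _.
apply: lerD => //; case: ifP => // _; rewrite height0 //.
Qed.

Lemma height_root_pbound n B p x :
  p \is monic -> pbound n.+1 B p -> root p x -> height x <= n%:R * (B + 1).
Proof.
move=> mon hp r0; apply: le_trans (height_monic_root R mon r0) _.
have B0 := pbound_ge0 hp; case: hp => sp hp.
have mn : ((size p).-1 <= n)%N by rewrite -ltnS prednK // size_poly_gt0 monic_neq0.
apply: le_trans (_ : _ <= (size p).-1%:R * (B + 1)) _.
  rewrite mulr_natl -[X in _ <= _ *+ X]card_ord -sumr_const ler_sum // => i _.
  by rewrite lerD2r.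
by rewrite ler_wpM2r ?ler_nat //; lra.
Qed.

Lemma monic_addl p q : p \is monic -> (size q < size p)%N -> p + q \is monic.
Proof. by move=> mon lt; rewrite monicE lead_coefDl // -monicE. Qed.

End PolynomialHeight.

Section ThreePoints.
Variable R : realType.
Local Notation height := (height R).
Local Notation pbound := (@pbound R).

Variables (p q d : rat) (B : R).
Hypothesis dE : d = 1 + p + q.
Hypothesis B1 : 1 <= B.
Hypothesis hp : height p <= B.
Hypothesis hq : height q <= B.

Let cubic : {poly rat} := Poly [:: q; p; 0; 1].

Let cubicE x : cubic.[x] = x ^+ 3 + p * x + q.
Proof. by rewrite horner_Poly /=; ring. Qed.

Let cubic_pbound : pbound 4 B cubic.
Proof.
apply: (@pbound_Poly _ [:: _; _; _; _]) => [|x]; first by move: B1; lra.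
rewrite !inE => /or4P[] /eqP-> //; first by rewrite height0; move: B1; lra.
by rewrite height1; move: B1; lra.
Qed.

Let cubic_size : size cubic = 4.
Proof. by rewrite (PolyK (c := 0)) //= oner_neq0. Qed.

Let cubic_monic : cubic \is monic.
Proof. by rewrite monicE lead_coefE cubic_size coef_Poly. Qed.

Let hd : height d <= 4 * B.
Proof.
rewrite dE; have := heightD R (1 + p) q; have := heightD R 1 p; rewrite height1.
move: hp hq B1; lra.
Qed.

Let sq_pbound c : height c <= B -> pbound 3 (6 * B) (('X - c%:P) * ('X - c%:P)).
Proof.
move=> hc; apply: pbound_le (pboundM (pboundXsubC R c) (pboundXsubC R c)) => //.
by move: B1; lra.
Qed.

(** On d Y^2 = X^3 + p X + q the points are R = (1, 1), S = (a, b) and P = (xi, eta); s and t are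
    slopes of chords, xi2 and xi3 the abscissae of P + R and P + S. Multiplied by (xi - 1)^2 (xi -
    a)^2, the relation is linear in eta: L(xi) = - 2 d eta M(xi). Squaring eliminates eta and makes
    xi a root of G. Since L is monic of degree 5 and M has degree at most 2, G is monic of degree
    10. *)
Lemma height_of_x_progression (a b k xi eta s t xi2 xi3 : rat) :
  height a <= B -> height b <= B -> height k <= B ->
  d * b ^+ 2 = a ^+ 3 + p * a + q -> d * eta ^+ 2 = xi ^+ 3 + p * xi + q ->
  s * (xi - 1) = eta - 1 -> t * (xi - a) = eta - b ->
  xi2 = d * s ^+ 2 - xi - 1 -> xi3 = d * t ^+ 2 - xi - a ->
  k * xi2 - (k - 1) * xi3 = xi ->
  height xi <= 300 * (100 * B).
Proof.
move=> ha hb hk eb eeta es et e2 e3 ek.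
(* The part free of eta in the numerator d (eta - b)^2 - (xi + c) (xi - c)^2 of the added abscissa.
   The cubic terms cancel; this is what keeps L monic. *)
pose A c : {poly rat} := Poly [:: 2 * q + p * c; p + c ^+ 2; c].
have AE c x : (A c).[x] = c * x ^+ 2 + (p + c ^+ 2) * x + 2 * q + p * c.
  by rewrite horner_Poly /=; ring.
have A_pbound c : height c <= B -> pbound 3 (6 * B) (A c).
  move=> hc; apply: (@pbound_Poly _ [:: _; _; _]) => [|x]; first by move: B1; lra.
  rewrite !inE => /or3P[] /eqP->.
  - have := heightD R (2 * q) (p * c); have := heightM R 2 q.
    have := heightM R p c; have := height_nat R 2; move: hp hq B1; lra.
  - have := heightD R p (c ^+ 2); rewrite heightX; move: hp B1; lra.
  - by move: B1; lra.
pose l1 : {poly rat} := 'X - 1%:P; pose la : {poly rat} := 'X - a%:P.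
pose m : {poly rat} := 'X * (l1 * l1 * (la * la)).
pose m' : {poly rat} := k%:P * A 1 * (la * la) - (k - 1)%:P * A a * (l1 * l1).
pose M : {poly rat} := k%:P * (la * la) - ((k - 1) * b)%:P * (l1 * l1).
pose L : {poly rat} := m - m'.
pose G : {poly rat} := L * L - (4 * d)%:P * (cubic * (M * M)).
have h1 : height 1 <= B by rewrite height1; move: B1; lra.
have hk1 : height (k - 1) <= 2 * B.
  by have := heightB R k 1; rewrite height1; move: B1; lra.
have m_pbound : pbound 6 (80 * B) m.
  have H := pboundM (sq_pbound h1) (sq_pbound ha).
  by apply: pbound_le (pboundM (pboundX R) H) => //=; move: B1; lra.
have m'_pbound : pbound 5 (94 * B) m'.
  have H1 := pboundM (pboundM (pboundC R k) (A_pbound _ h1)) (sq_pbound ha).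
  have H2 := pboundM (pboundM (pboundC R (k - 1)) (A_pbound _ ha)) (sq_pbound h1).
  by apply: pbound_le (pboundB H1 H2) => //=; move: B1; lra.
have M_pbound : pbound 3 (19 * B) M.
  have H1 := pboundM (pboundC R k) (sq_pbound ha).
  have H2 := pboundM (pboundC R ((k - 1) * b)) (sq_pbound h1).
  apply: pbound_le (pboundB H1 H2) => //=.
  by have := heightM R (k - 1) b; move: B1; lra.
have L_pbound : pbound 6 (175 * B) L.
  by apply: pbound_le (pboundB m_pbound m'_pbound) => //=; move: B1; lra.
have cM_pbound : pbound 8 (490 * B) ((4 * d)%:P * (cubic * (M * M))).
  have H := pboundM (pboundC R (4 * d)) (pboundM cubic_pbound (pboundM M_pbound M_pbound)).
  apply: pbound_le H => //=.
  by have := heightM R 4 d; have := height_nat R 4; move: hd B1; lra.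
have G_pbound : pbound 11 (2700 * B) G.
  apply: pbound_le (pboundB (pboundM L_pbound L_pbound) cM_pbound) => //=.
  by move: B1; lra.
have m_monic : m \is monic by rewrite /m !rpredM ?monicX ?monicXsubC.
have m_size : size m = 6.
  by rewrite /m !size_mul ?mulf_neq0 ?polyX_eq0 ?polyXsubC_eq0 // size_polyX !size_XsubC.
have L_size : size L = 6.
  by rewrite /L size_polyDl m_size ?size_polyN //; case: m'_pbound.
have L_monic : L \is monic.
  by apply: monic_addl => //; rewrite m_size size_polyN; case: m'_pbound.
have G_monic : G \is monic.
  apply: monic_addl; first by rewrite rpredM.
  rewrite size_mul ?monic_neq0 // L_size size_polyN.
  by case: cM_pbound => H _; apply: leq_ltn_trans H _.
have G_root : root G xi.
  have a1 : (A 1).[xi] = xi2 * (xi - 1) ^+ 2 + 2 * d * eta.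
    have -> : xi2 * (xi - 1) ^+ 2 = d * (s * (xi - 1)) ^+ 2 - (xi + 1) * (xi - 1) ^+ 2.
      by rewrite e2; ring.
    have -> : d * (s * (xi - 1)) ^+ 2 = d * eta ^+ 2 - 2 * d * eta + d by rewrite es; ring.
    by rewrite eeta AE dE; ring.
  have aa : (A a).[xi] = xi3 * (xi - a) ^+ 2 + 2 * d * b * eta.
    have -> : xi3 * (xi - a) ^+ 2 = d * (t * (xi - a)) ^+ 2 - (xi + a) * (xi - a) ^+ 2.
      by rewrite e3; ring.
    have -> : d * (t * (xi - a)) ^+ 2 = d * eta ^+ 2 - 2 * d * b * eta + d * b ^+ 2.
      by rewrite et; ring.
    by rewrite eeta eb AE; ring.
  have LE : L.[xi] = - 2 * d * eta * M.[xi].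
    rewrite /L /m /m' /M !(hornerD, hornerN, hornerM, hornerC, hornerX, a1, aa).
    apply/eqP; rewrite -subr_eq0; apply/eqP.
    transitivity ((xi - (k * xi2 - (k - 1) * xi3)) * ((xi - 1) ^+ 2 * (xi - a) ^+ 2)).
      by ring.
    by rewrite ek subrr mul0r.
  apply/rootP; rewrite /G hornerD hornerN !hornerM hornerC LE cubicE -eeta; ring.
apply: le_trans (height_root_pbound G_monic G_pbound G_root) _.
by move: B1; lra.
Qed.

(** Same setting, with the ordinates of P + R and P + S. After multiplication by (xi - 1)^3 (xi -
    a)^3 and by the curve equation, the relation reads eta L(xi) = M(xi). Hence G = cubic L^2 - d
    M^2 vanishes at xi; the first term is monic of degree 15, the second has degree at most 12. *)
Lemma height_of_y_progression (a b k xi eta s t xi2 xi3 : rat) :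
  height a <= B -> height b <= B -> height k <= B ->
  d * b ^+ 2 = a ^+ 3 + p * a + q -> d * eta ^+ 2 = xi ^+ 3 + p * xi + q ->
  s * (xi - 1) = eta - 1 -> t * (xi - a) = eta - b ->
  xi2 = d * s ^+ 2 - xi - 1 -> xi3 = d * t ^+ 2 - xi - a ->
  k * (s * (1 - xi2) - 1) - (k - 1) * (t * (a - xi3) - b) = eta ->
  height xi <= 1000 * (400 * B).
Proof.
move=> ha hb hk eb eeta es et e2 e3 ek.
(* For the sum of (xi, eta) and (c, b'), the ordinate times (xi - c)^3 is eta C(xi) + b' D(xi) (see
   [add_y]). *)
pose C c : {poly rat} := Poly [:: - c ^+ 3 - 3 * p * c - 4 * q; - (p + 3 * c ^+ 2)].
pose D c : {poly rat} := Poly [:: 4 * q + p * c; 3 * p; 3 * c; 1].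
have CE c x : (C c).[x] = - (p + 3 * c ^+ 2) * x - c ^+ 3 - 3 * p * c - 4 * q.
  by rewrite horner_Poly /=; ring.
have DE c x : (D c).[x] = x ^+ 3 + 3 * c * x ^+ 2 + 3 * p * x + 4 * q + p * c.
  by rewrite horner_Poly /=; ring.
have h3 := height_nat R 3; have h4 := height_nat R 4.
have C_pbound c : height c <= B -> pbound 2 (15 * B) (C c).
  move=> hc; apply: (@pbound_Poly _ [:: _; _]) => [|x]; first by move: B1; lra.
  rewrite !inE => /orP[] /eqP->.
  - have := heightB R (- c ^+ 3 - 3 * p * c) (4 * q); have := heightM R 4 q.
    have := heightB R (- c ^+ 3) (3 * p * c); rewrite heightN heightX.
    have := heightM R (3 * p) c; have := heightM R 3 p.
    by move: hp hq B1; lra.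
  - rewrite heightN; have := heightD R p (3 * c ^+ 2); have := heightM R 3 (c ^+ 2).
    by rewrite heightX; move: hp B1; lra.
have D_pbound c : height c <= B -> pbound 4 (8 * B) (D c).
  move=> hc; apply: (@pbound_Poly _ [:: _; _; _; _]) => [|x]; first by move: B1; lra.
  rewrite !inE => /or4P[] /eqP->.
  - have := heightD R (4 * q) (p * c); have := heightM R 4 q.
    by have := heightM R p c; move: hp hq B1; lra.
  - by have := heightM R 3 p; move: hp B1; lra.
  - by have := heightM R 3 c; move: B1; lra.
  - by rewrite height1; move: B1; lra.
pose l1 : {poly rat} := 'X - 1%:P; pose la : {poly rat} := 'X - a%:P.
pose cube (l : {poly rat}) : {poly rat} := l * l * l.
pose m : {poly rat} := cube l1 * cube la.
pose m' : {poly rat} := k%:P * C 1 * cube la - (k - 1)%:P * C a * cube l1.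
pose M : {poly rat} := k%:P * D 1 * cube la - ((k - 1) * b)%:P * D a * cube l1.
pose L : {poly rat} := m - m'.
pose G : {poly rat} := cubic * (L * L) - d%:P * (M * M).
have h1 : height 1 <= B by rewrite height1; move: B1; lra.
have hk1 : height (k - 1) <= 2 * B.
  by have := heightB R k 1; rewrite height1; move: B1; lra.
have cube_pbound c : height c <= B -> pbound 4 (24 * B) (cube ('X - c%:P)).
  move=> hc; apply: pbound_le (pboundM (sq_pbound hc) (pboundXsubC R c)) => //.
  by move: B1; lra.
have m_pbound : pbound 7 (196 * B) m.
  have H := pboundM (cube_pbound _ h1) (cube_pbound _ ha).
  by apply: pbound_le H => //=; move: B1; lra.
have m'_pbound : pbound 5 (171 * B) m'.
  have H1 := pboundM (pboundM (pboundC R k) (C_pbound _ h1)) (cube_pbound _ ha).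
  have H2 := pboundM (pboundM (pboundC R (k - 1)) (C_pbound _ ha)) (cube_pbound _ h1).
  by apply: pbound_le (pboundB H1 H2) => //=; move: B1; lra.
have M_pbound : pbound 7 (289 * B) M.
  have H1 := pboundM (pboundM (pboundC R k) (D_pbound _ h1)) (cube_pbound _ ha).
  have H2 := pboundM (pboundM (pboundC R ((k - 1) * b)) (D_pbound _ ha)) (cube_pbound _ h1).
  apply: pbound_le (pboundB H1 H2) => //=.
  by have := heightM R (k - 1) b; move: B1; lra.
have L_pbound : pbound 7 (368 * B) L.
  by apply: pbound_le (pboundB m_pbound m'_pbound) => //=; move: B1; lra.
have cL_pbound : pbound 16 (100 * (207 * B)) (cubic * (L * L)).
  by apply: pbound_le (pboundM cubic_pbound (pboundM L_pbound L_pbound)) => //=; move: B1; lra.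
have dM_pbound : pbound 13 (4060 * B) (d%:P * (M * M)).
  apply: pbound_le (pboundM (pboundC R d) (pboundM M_pbound M_pbound)) => //=.
  by move: hd B1; lra.
have G_pbound : pbound 16 (100 * (250 * B)) G.
  by apply: pbound_le (pboundB cL_pbound dM_pbound) => //=; move: B1; lra.
have m_monic : m \is monic by rewrite /m /cube !rpredM ?monicXsubC.
have m_size : size m = 7.
  by rewrite /m /cube !size_mul ?mulf_neq0 ?polyXsubC_eq0 // !size_XsubC.
have L_size : size L = 7.
  rewrite /L size_polyDl m_size ?size_polyN //.
  by case: m'_pbound => H _; apply: leq_ltn_trans H _.
have L_monic : L \is monic.
  apply: monic_addl => //; rewrite m_size size_polyN.
  by case: m'_pbound => H _; apply: leq_ltn_trans H _.
have G_monic : G \is monic.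
  apply: monic_addl; first by rewrite !rpredM.
  rewrite !size_mul ?mulf_neq0 ?monic_neq0 // L_size cubic_size size_polyN.
  by case: dM_pbound => H _; apply: leq_ltn_trans H _.
have G_root : root G xi.
  have add_y c b' r x3 : d * b' ^+ 2 = c ^+ 3 + p * c + q ->
      r * (xi - c) = eta - b' -> x3 = d * r ^+ 2 - xi - c ->
      (r * (c - x3) - b') * (xi - c) ^+ 3 = eta * (C c).[xi] + b' * (D c).[xi].
    move=> ebc er ->; rewrite CE DE.
    transitivity ((r * (xi - c)) * ((2 * c + xi) * (xi - c) ^+ 2
        - d * (r * (xi - c)) ^+ 2) - b' * (xi - c) ^+ 3); first by ring.
    rewrite er.
    transitivity ((eta - b') * ((2 * c + xi) * (xi - c) ^+ 2
        - (d * eta ^+ 2) - d * b' ^+ 2) + 2 * b' * (d * eta ^+ 2)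
        - 2 * eta * (d * b' ^+ 2) - b' * (xi - c) ^+ 3); first by ring.
    by rewrite eeta ebc; ring.
  have y1 : (s * (1 - xi2) - 1) * (xi - 1) ^+ 3 = eta * (C 1).[xi] + 1 * (D 1).[xi].
    by apply: add_y => //; rewrite dE; ring.
  have ya := add_y a b t xi3 eb et e3.
  have LE : eta * L.[xi] = M.[xi].
    rewrite /L /m /m' /M /cube !(hornerD, hornerN, hornerM, hornerC, hornerX).
    apply/eqP; rewrite -subr_eq0; apply/eqP.
    transitivity (eta * ((xi - 1) ^+ 3 * (xi - a) ^+ 3)
      - k * (eta * (C 1).[xi] + 1 * (D 1).[xi]) * (xi - a) ^+ 3
      + (k - 1) * (eta * (C a).[xi] + b * (D a).[xi]) * (xi - 1) ^+ 3).
      by ring.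
    by rewrite -y1 -ya -ek; ring.
  apply/rootP; rewrite /G hornerD hornerN !hornerM hornerC -LE cubicE -eeta; ring.
apply: le_trans (height_root_pbound G_monic G_pbound G_root) _.
by move: B1; lra.
Qed.

End ThreePoints.

(** * Packing *)

(** Tensor power trick: by Bernoulli (1 + 1/M)^k >= 1 + k/M, which exceeds A at k = A M + 1, so t >=
    M + 1 is impossible. *)
Lemma leq_of_exp_bound A M t :
  (0 < M)%N -> (forall k, t ^ k <= A * M ^ k)%N -> (t <= M)%N.
Proof.
move=> M0 le; rewrite leqNgt; apply/negP => Mt.
have bernoulli k : (M ^ k * (M + k) <= M.+1 ^ k * M)%N.
  elim: k => [|k IH]; first by rewrite addn0.
  rewrite !expnS; have := leq_mul (leqnn M.+1) IH; have := leq_mul (leqnn M) IH; nia.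
have := bernoulli (A * M).+1; have := le (A * M).+1; set k := (A * M).+1.
have Mk0 : (0 < M ^ k)%N by rewrite expn_gt0 M0.
have tk : (M.+1 ^ k <= t ^ k)%N by rewrite leq_exp2r.
move=> h1 h2; have : (M ^ k * (M + k) <= M ^ k * (A * M))%N.
  by apply: leq_trans h2 _; nia.
by rewrite leq_pmul2l // /k; lia.
Qed.

Lemma size_le_fibers (T U : eqType) (f : T -> U) (s : seq T) (ys : seq U) (L : nat) :
  (forall x, x \in s -> f x \in ys) ->
  (forall y, (count (fun x => f x == y) s <= L)%N) ->
  (size s <= size ys * L)%N.
Proof.
move=> im fib; elim: ys s im fib => [|y ys IH] s im fib.
  by case: s im {fib} => // x s /(_ x (mem_head _ _)).
rewrite -(count_predC (fun x => f x == y) s) /= mulSn leq_add //.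
rewrite -size_filter; apply: IH => [x|z].
  by rewrite mem_filter => /andP[/= /negPf fx /im]; rewrite in_cons fx.
rewrite count_filter; apply: leq_trans (fib z); apply: sub_count => x /=.
by case/andP.
Qed.

Section Packing.
Variables (R : realType) (V : zmodType) (N : V -> R) (K C : R) (r : nat).
Variable g : 'I_r -> V.
Hypothesis K1 : 1 <= K.
Hypothesis C0 : 0 <= C.
Hypothesis N_ge0 : forall x, 0 <= N x.
Hypothesis NB : forall x y, N (x - y) <= K * (N x + N y) + C.
Hypothesis N2 : forall x, 4 * N x - C <= N (x *+ 2).
Hypothesis rankV : forall x, exists n (k : 'I_r -> int),
  (0 < n)%N /\ x *+ n = \sum_i g i *~ k i.

(** C/3 is the fixed point of v -> 4 v - C. Shifting by it turns the duplication inequality into an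
    exact factor 4, without accumulated error. *)
Lemma N_mul_pow2 s x : 4 ^+ s * (N x - C / 3) <= N (x *+ (2 ^ s)) - C / 3.
Proof.
elim: s => [|s IH]; first by rewrite expr0 mul1r.
rewrite expnSr mulrnA exprS; have := N2 (x *+ (2 ^ s)).
by move: IH; set u := 4 ^+ s * _; rewrite -mulrA -/u; lra.
Qed.

(** The multiples of x form a finite set, on which N is bounded, whereas N x > C/3 would make N grow
    like 4^s along the 2^s x. *)
Lemma N_torsion n x : (0 < n)%N -> x *+ n = 0 -> N x <= C / 3.
Proof.
move=> n0 xn; rewrite leNgt; apply/negP => gt.
pose b := \sum_(j < n) N (x *+ j).
have bd s : N (x *+ (2 ^ s)) <= b.
  rewrite (divn_eq (2 ^ s) n) mulrnDr mulnC mulrnA xn mul0rn add0r.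
  rewrite /b (bigD1 (Ordinal (ltn_pmod (2 ^ s) n0))) //= lerDl.
  by apply: sumr_ge0.
have d0 : 0 < N x - C / 3 by lra.
have [s /ltW hs] : exists s : nat, b / (N x - C / 3) < s%:R.
  by exists (Num.bound (b / (N x - C / 3))); apply: archi_boundP; rewrite divr_ge0 ?sumr_ge0 // ltW.
have s4 : (s.+1%:R : R) <= 4 ^+ s.
  by rewrite -natrX ler_nat; apply: leq_trans (ltn_expl s (isT : 1 < 2)%N) _; case: s {hs} => // s; rewrite leq_exp2r.
have := N_mul_pow2 s x; have := bd s.
move: hs; rewrite ler_pdivrMr // => hs.
have : s.+1%:R * (N x - C / 3) <= 4 ^+ s * (N x - C / 3) by rewrite ler_pM2r.
by rewrite -natr1; move: hs d0 C0; lra.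
Qed.

Variables (rho delta : R) (s t : nat) (a : 'I_t -> V).
Let m := (2 ^ s.+1)%N.
Hypothesis C_delta : C / 3 < delta.
(** The right side is the height gained by multiplying a separated difference by m. The left side is
    what adding a difference of two digits, of height at most 2 K rho + C, may cost while leaving
    [delta]. *)
Hypothesis m_large : K * delta + C + K * (2 * K * rho + C) <= 4 ^+ s.+1 * (delta - C / 3).
Hypothesis a_ball : forall i, N (a i) <= rho.
Hypothesis a_sep : forall i j, i != j -> delta <= N (a i - a j).

Let word (w : seq 'I_t) : V := foldl (fun v i => v *+ m + a i) 0 w.

Let word_rcons w i : word (rcons w i) = word w *+ m + a i.
Proof. by rewrite /word foldl_rcons. Qed.

(* Horner sums in the large base [m] inherit the separation of the digits. *)
Lemma word_sep w w' : size w = size w' -> w != w' -> delta <= N (word w - word w').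
Proof.
elim/last_ind: w w' => [|w i IH] w'; first by case: w'.
case/lastP: w' => [|w' j]; first by rewrite size_rcons.
rewrite !size_rcons => -[sz]; rewrite eqseq_rcons !word_rcons.
have -> : word w *+ m + a i - (word w' *+ m + a j) =
    (word w - word w') *+ m + (a i - a j) by rewrite mulrnBl opprD addrACA.
have [<- /= ij|ww' _] := eqVneq w w'.
  by rewrite subrr mul0rn add0r a_sep.
have h1 := IH _ sz ww'; have h2 := N_mul_pow2 s.+1 (word w - word w').
set A := _ *+ m; set D := a i - a j.
have := NB (A + D) D; rewrite addrK => h3.
have h4 := NB (a i) (a j); have h5 := a_ball i; have h6 := a_ball j.
have h7 : 4 ^+ s.+1 * (delta - C / 3) <= 4 ^+ s.+1 * (N (word w - word w') - C / 3).
  by rewrite ler_pM2l ?exprn_gt0 // lerD2r.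
have K0 : 0 < K by apply: lt_le_trans K1.
have h8 : K * (N (a i) + N (a j)) <= K * (2 * rho) by rewrite ler_pM2l //; lra.
have h9 : K * N D <= K * (2 * K * rho + C).
  by rewrite ler_pM2l // /D; lra.
have h10 : K * delta <= K * N (A + D).
  by move: C0 m_large h2 h3 h7 h9; rewrite -/m -/A; move: (4 ^+ s.+1) => q; lra.
by move: h10; rewrite ler_pM2l //; lra.
Qed.

(** A common multiple n puts n times every word into the span of g. Words of equal length with equal
    coordinates differ by torsion, of height at most C/3 < [delta], hence coincide. Counting words
    of length k gives t^k <= (3 B)^r (m^r)^k for all k, and [leq_of_exp_bound] removes the
    constant. *)
Lemma packing : (t <= (2 ^ s.+1) ^ r)%N.
Proof.
have /fin_all_exists2 : forall i, exists2 nk : nat * ('I_r -> int),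
    (0 < nk.1)%N & a i *+ nk.1 = \sum_l g l *~ nk.2 l.
  by move=> i; have [n [k [n0 e]]] := rankV (a i); exists (n, k).
case=> nk nk0 nkE; pose n := (\prod_i (nk i).1)%N.
have n0 : (0 < n)%N by apply: prodn_gt0.
pose c i l := (nk i).2 l * (n %/ (nk i).1)%N%:Z.
have aE i : a i *+ n = \sum_l g l *~ c i l.
  have dv : ((nk i).1 %| n)%N by rewrite /n (bigD1 i) //= dvdn_mulr.
  rewrite -{1}(divnK dv) mulnC mulrnA nkE -sumrMnl; apply: eq_bigr => l _.
  by rewrite /c mulrzA pmulrn.
pose B := (\sum_i \sum_l absz (c i l)).+1.
have cB i l : (absz (c i l) < B)%N.
  rewrite ltnS (bigD1 i) //= (bigD1 l) //= -addnA leq_addr //.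
pose coef (w : seq 'I_t) l : int := foldl (fun z i => z * m%:Z + c i l) 0 w.
have coef_rcons w i l : coef (rcons w i) l = coef w l * m%:Z + c i l.
  by rewrite /coef foldl_rcons.
have wordE w : word w *+ n = \sum_l g l *~ coef w l.
  elim/last_ind: w => [|w i IH]; first by rewrite mul0rn big1.
  rewrite word_rcons mulrnDl mulrnAC IH aE -sumrMnl -big_split /=.
  by apply: eq_bigr => l _; rewrite coef_rcons mulrzDr mulrzA pmulrn.
have m2 : (2 <= m)%N by rewrite /m expnS leq_pmulr // expn_gt0.
(* The summand B on the left makes the bound reproduce itself under the Horner step, because m >=
   2. *)
have coefB w l : (absz (coef w l) + B <= B * m ^ size w)%N.
  elim/last_ind: w => [|w i IH]; first by rewrite /coef /= muln1.
  rewrite size_rcons coef_rcons expnS; have := cB i l.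
  have h : (absz (coef w l * m%:Z + c i l)%R <= absz (coef w l) * m + absz (c i l))%N by lia.
  by move=> h'; nia.
have word_inj w w' : size w = size w' -> coef w =1 coef w' -> w = w'.
  move=> sz e; apply/eqP; apply/negPn/negP => ne.
  have := word_sep sz ne; rewrite leNgt => /negP; apply.
  apply: le_lt_trans C_delta; apply: (N_torsion n0).
  rewrite mulrnBl !wordE -sumrB big1 // => l _.
  by rewrite e subrr.
apply: (@leq_of_exp_bound ((3 * B) ^ r)); first by rewrite !expn_gt0.
move=> k; pose M := (2 * (B * m ^ k))%N.
(* Coordinates lie between - B m^k and B m^k; the shift makes them natural numbers up to M. *)
pose code (w : k.-tuple 'I_t) : {ffun 'I_r -> 'I_M.+1} :=
  [ffun l => inord (absz (coef w l + (B * m ^ k)%N%:Z))].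
have code_inj : injective code.
  move=> w w' e; apply: val_inj; apply: word_inj; first by rewrite !size_tuple.
  move=> l; have /(congr1 val) := congr1 (fun f : {ffun _} => f l) e.
  have := coefB w l; have := coefB w' l; rewrite !size_tuple !ffunE => h h' /=.
  by rewrite !inordK /M; lia.
have := leq_card code code_inj; rewrite card_tuple card_ffun !card_ord.
move=> le; apply: leq_trans le _; rewrite -/m.
have -> : ((3 * B) ^ r * (m ^ r) ^ k = (3 * (B * m ^ k)) ^ r)%N.
  by rewrite mulnA [RHS]expnMn -!expnM (mulnC r).
have : (M.+1 <= 3 * (B * m ^ k))%N.
  by rewrite /M; have : (0 < B * m ^ k)%N; [rewrite muln_gt0 expn_gt0 /m expn_gt0 | lia].
by case: (r) => // r' le; rewrite leq_exp2r.
Qed.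

End Packing.

(* Greedily choose centres at mutual distance at least [delta]. *)
Lemma separated_net (V : eqType) (close : rel V) (s : seq V) :
  reflexive close -> symmetric close ->
  exists c : seq V, [/\ {subset c <= s}, pairwise (fun x y => ~~ close x y) c &
    forall x, x \in s -> exists2 y, y \in c & close x y].
Proof.
move=> refl sym; elim: s => [|x s [c [cs sep cov]]]; first by exists [::].
have [/hasP[y yc xy]|far] := boolP (has (close x) c).
  exists c; split=> // [z /cs|z]; first by rewrite in_cons => ->; rewrite orbT.
  by rewrite in_cons => /orP[/eqP->|/cov //]; exists y.
exists (x :: c); split.
- by move=> z; rewrite !in_cons => /orP[->//|/cs ->]; rewrite orbT.
- by rewrite /= sep andbT all_predC.
move=> z; rewrite in_cons => /orP[/eqP->|/cov[y yc zy]].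
  by exists x; rewrite ?mem_head.
by exists y; rewrite // in_cons yc orbT.
Qed.

(** A maximal [delta]-separated net in S has at most m^r centres by [packing]. Sending each point to
    its first close centre gives fibres inside [delta]-balls. *)
Lemma size_le_balls (R : realType) (V : zmodType) (N : V -> R) (K C : R) (r : nat)
    (g : 'I_r -> V) (rho delta : R) (s L : nat) (S : seq V) :
  1 <= K -> 0 <= C -> (forall x, 0 <= N x) -> N 0 = 0 -> (forall x, N (- x) = N x) ->
  (forall x y, N (x - y) <= K * (N x + N y) + C) ->
  (forall x, 4 * N x - C <= N (x *+ 2)) ->
  (forall x, exists n (k : 'I_r -> int), (0 < n)%N /\ x *+ n = \sum_i g i *~ k i) ->
  0 < delta -> C / 3 < delta ->
  K * delta + C + K * (2 * K * rho + C) <= 4 ^+ s.+1 * (delta - C / 3) ->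
  (forall x, x \in S -> N x <= rho) ->
  (forall y, y \in S -> (count (fun x => (N (x - y) < delta)%R) S <= L)%N) ->
  (size S <= (2 ^ s.+1) ^ r * L)%N.
Proof.
move=> K1 C0 N0 Nz NN NB N2 rk d0 Cd ml ball cnt.
pose close x y := N (x - y) < delta.
have [c [cS sep cov]] : exists c : seq V,
    [/\ {subset c <= S}, pairwise (fun x y => ~~ close x y) c &
      forall x, x \in S -> exists2 y, y \in c & close x y].
  apply: separated_net => [x|x y]; first by rewrite /close subrr Nz.
  by rewrite /close -opprB NN.
have szc : (size c <= (2 ^ s.+1) ^ r)%N.
  apply: (@packing R V N K C r g K1 C0 N0 NB N2 rk rho delta s (size c)
    (fun i => nth 0 c i)) => //.
    by move=> i; apply/ball/cS/mem_nth.
  have lt_sep (i j : 'I_(size c)) : (i < j)%N -> delta <= N (nth 0 c i - nth 0 c j).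
    move=> ij; rewrite leNgt.
    by have /(pairwiseP 0) := sep; apply=> //; rewrite inE.
  move=> i j; rewrite neq_ltn => /orP[/lt_sep//|/lt_sep].
  by rewrite -opprB NN.
pose f x := nth 0 c (find (fun y => close x y) c).
apply: leq_trans (leq_mul szc (leqnn L)).
apply: (@size_le_fibers _ _ f).
  move=> x /cov[y yc xy]; apply: mem_nth; rewrite -has_find.
  by apply/hasP; exists y.
move=> y; have [yc|yc] := boolP (y \in c); last first.
  rewrite (@eq_in_count _ _ pred0) ?count_pred0 // => x /cov[z zc xz] /=.
  apply/negbTE; apply: contraNneq yc => <-; apply: mem_nth; rewrite -has_find.
  by apply/hasP; exists z.
apply: leq_trans (cnt y (cS _ yc)).
rewrite -[X in (X <= _)%N](@eq_in_count _ (fun x => (x \in S) && (f x == y))).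
  apply: sub_count => x /andP[xS /eqP <-]; have [z zc xz] := cov x xS.
  have : has (fun y => close x y) c by apply/hasP; exists z.
  by move/(nth_find 0).
by move=> x xS; rewrite xS.
Qed.

(** * Heights under duplication *)

Section Bezout.
Variable R : realType.

Lemma absz_le_bezout (a b f g c : int) (A M D H : R) :
  a * f + b * g = c ->
  (absz a)%:R <= A * M -> (absz b)%:R <= A * M ->
  (absz f)%:R <= D * H -> (absz g)%:R <= D * H -> (absz c)%:R <= 2 * A * M * D * H.
Proof.
move=> <- ha hb hf hg.
have tri : ((absz (a * f + b * g)%R)%:R : R) <=
    (absz a)%:R * (absz f)%:R + (absz b)%:R * (absz g)%:R.
  by rewrite -!natrM -natrD ler_nat; lia.
apply: le_trans tri _.
have h1 : (absz a)%:R * (absz f)%:R <= A * M * (D * H) by rewrite ler_pM.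
have h2 : (absz b)%:R * (absz g)%:R <= A * M * (D * H) by rewrite ler_pM.
by lra.
Qed.

(* The common factor of the two forms divides the resultant [rho], so that it
   cancels in the height of their quotient. *)
Lemma mheight_bezout (x z f g rho f1 g1 f2 g2 : int) (A : R) (y : rat) :
  let M : R := (maxn `|x| `|z|)%:R in
  coprime `|x| `|z| -> rho != 0 ->
  f1 * f + g1 * g = rho * x ^+ 7 -> f2 * f + g2 * g = rho * z ^+ 7 ->
  (absz f1)%:R <= A * M ^+ 3 -> (absz g1)%:R <= A * M ^+ 3 ->
  (absz f2)%:R <= A * M ^+ 3 -> (absz g2)%:R <= A * M ^+ 3 ->
  (g != 0 -> y = f%:~R / g%:~R) -> (g = 0 -> y = 0) ->
  M ^+ 4 <= 2 * A * (mheight y)%:R.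
Proof.
move=> M cop rho0 ex ez hf1 hg1 hf2 hg2 yE y0.
have M0 : 0 < M.
  rewrite /M ltr0n leq_max !absz_gt0; apply: contraLR cop.
  by rewrite negb_or !negbK => /andP[/eqP-> /eqP->].
pose d := gcdn `|f| `|g|.
have dvf : (d %| `|f|)%N by apply: dvdn_gcdl.
have dvg : (d %| `|g|)%N by apply: dvdn_gcdr.
have dv_rho : (d %| `|rho|)%N.
  have cop7 : coprime (absz (x ^+ 7)) (absz (z ^+ 7)).
    by rewrite !abszX coprimeXl // coprimeXr.
  have : (d %| gcdn (absz (rho * x ^+ 7)%R) (absz (rho * z ^+ 7)%R))%N.
    have dv (a b : int) : (d%:Z %| a * f + b * g)%Z.
      by rewrite rpredD // dvdz_mull // dvdzE.
    by rewrite dvdn_gcd -ex -ez; apply/andP; split; [have := dv f1 g1 | have := dv f2 g2]; rewrite dvdzE.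
  by rewrite !(abszM rho) -muln_gcdr (eqP cop7) muln1.
have d_gt0 : (0 < d)%N by apply: dvdn_gt0 dv_rho; rewrite absz_gt0.
have d_rho : (d%:R : R) <= (absz rho)%:R by rewrite ler_nat dvdn_leq // absz_gt0.
pose H := (mheight y)%:R : R.
have [hf hg] : (absz f)%:R <= d%:R * H /\ (absz g)%:R <= d%:R * H.
  (* For g = 0 the convention y = 0 gives H = 1 while d = |f|, so both bounds survive. *)
  have [g0|g0] := eqVneq g 0.
    rewrite /H y0 // mulr1 /d g0 /= gcdn0; split => //.
  have [f' fE] : exists f', f = d%:Z * f' by exists (f %/ d%:Z)%Z; rewrite mulrC divzK ?dvdzE.
  have [g' gE] : exists g', g = d%:Z * g' by exists (g %/ d%:Z)%Z; rewrite mulrC divzK ?dvdzE.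
  have g'0 : g' != 0 by apply: contraNneq g0 => g'0; rewrite gE g'0 mulr0.
  have cop' : coprime `|f'| `|g'|.
    have : (gcdn (absz f) (absz g) = d * 1)%N by rewrite muln1.
    rewrite {1}fE {1}gE !abszM -muln_gcdr => /eqP; rewrite eqn_pmul2l //.
  have -> : H = (maxn `|f'| `|g'|)%:R.
    have d0 : (d%:Z%:~R : rat) != 0 by rewrite intr_eq0 -lt0n.
    rewrite /H yE // fE gE !intrM -mulf_div divff // mul1r mheight_frac //.
  rewrite -!natrM !ler_nat fE gE !abszM /= !leq_mul ?leq_maxl ?leq_maxr //.
have key w : absz (rho * w ^+ 7) = (`|rho| * `|w| ^ 7)%N by rewrite abszM abszX.
have bx := absz_le_bezout ex hf1 hg1 hf hg.
have bz := absz_le_bezout ez hf2 hg2 hf hg.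
have bM : (absz rho)%:R * M ^+ 7 <= 2 * A * M ^+ 3 * d%:R * H.
  have [Mx|Mz] : M = (absz x)%:R \/ M = (absz z)%:R.
    by rewrite /M /maxn; case: ifP; [right | left].
    by move: bx; rewrite key natrM natrX -Mx.
  by move: bz; rewrite key natrM natrX -Mz.
have A0 : 0 <= A by have := le_trans (ler0n _ _) hf1; rewrite pmulr_lge0 // exprn_gt0.
have rho_gt0 : 0 < (absz rho)%:R :> R by rewrite ltr0n absz_gt0.
rewrite -(ler_pM2l (mulr_gt0 rho_gt0 (exprn_gt0 3 M0))).
apply: le_trans (_ : _ <= (absz rho)%:R * M ^+ 7) _.
  by rewrite -mulrA -exprD.
apply: le_trans bM _.
have -> : 2 * A * M ^+ 3 * d%:R * H = d%:R * (2 * A * M ^+ 3 * H) by ring.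
have -> : (absz rho)%:R * M ^+ 3 * (2 * A * H) = (absz rho)%:R * (2 * A * M ^+ 3 * H) by ring.
by rewrite ler_wpM2r // !mulr_ge0 ?exprn_ge0 ?ler0n //.
Qed.

Lemma cubic_form_le (M : nat) (c0 c1 c2 c3 x z : int) :
  (absz x <= M)%N -> (absz z <= M)%N ->
  (absz (c0 * x ^+ 3 + c1 * x ^+ 2 * z + c2 * x * z ^+ 2 + c3 * z ^+ 3)%R)%:R
    <= ((absz c0)%:R + (absz c1)%:R + (absz c2)%:R + (absz c3)%:R) * M%:R ^+ 3 :> R.
Proof.
move=> hx hz; rewrite -natrX -!natrD -natrM ler_nat.
have mono (c w : int) : (absz w <= M ^ 3 -> absz (c * w)%R <= absz c * M ^ 3)%N.
  by move=> hw; rewrite abszM leq_mul.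
have h0 := mono c0 (x ^+ 3); have h1 := mono c1 (x ^+ 2 * z).
have h2 := mono c2 (x * z ^+ 2); have h3 := mono c3 (z ^+ 3).
have {}h0 : (absz (c0 * x ^+ 3)%R <= absz c0 * M ^ 3)%N.
  by apply: h0; rewrite abszX leq_exp2r.
have {}h1 : (absz (c1 * (x ^+ 2 * z))%R <= absz c1 * M ^ 3)%N.
  by apply: h1; rewrite abszM abszX (expnSr M 2) leq_mul // leq_exp2r.
have {}h2 : (absz (c2 * (x * z ^+ 2))%R <= absz c2 * M ^ 3)%N.
  by apply: h2; rewrite abszM abszX (expnS M 2) leq_mul // leq_exp2r.
have {}h3 : (absz (c3 * z ^+ 3)%R <= absz c3 * M ^ 3)%N.
  by apply: h3; rewrite abszX leq_exp2r.
rewrite -(mulrA c1) -(mulrA c2) !mulnDl; move: h0 h1 h2 h3.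
move: (c0 * _) (c1 * _) (c2 * _) (c3 * _) => a0 a1 a2 a3; lia.
Qed.

End Bezout.

Section Duplication.
Variable R : realType.
Local Notation height := (height R).

Definition cubic_form (c0 c1 c2 c3 x z : int) : int :=
  c0 * x ^+ 3 + c1 * x ^+ 2 * z + c2 * x * z ^+ 2 + c3 * z ^+ 3.

Definition abs_sum (c0 c1 c2 c3 : int) : nat :=
  (absz c0 + absz c1 + absz c2 + absz c3)%N.

(** Two binary quartics without common zero generate, up to their resultant, all forms of degree 7
    with cubic cofactors; this explains the exponent 7 and the 16 coefficients. *)
Lemma height_bezout (X y : rat) (f g rho : int) (A : R)
    (a0 a1 a2 a3 b0 b1 b2 b3 c0 c1 c2 c3 d0 d1 d2 d3 : int) :
  let x := numq X in let z := denq X in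
  rho != 0 ->
  cubic_form a0 a1 a2 a3 x z * f + cubic_form b0 b1 b2 b3 x z * g = rho * x ^+ 7 ->
  cubic_form c0 c1 c2 c3 x z * f + cubic_form d0 d1 d2 d3 x z * g = rho * z ^+ 7 ->
  (abs_sum a0 a1 a2 a3)%:R <= A -> (abs_sum b0 b1 b2 b3)%:R <= A ->
  (abs_sum c0 c1 c2 c3)%:R <= A -> (abs_sum d0 d1 d2 d3)%:R <= A ->
  y = f%:~R / g%:~R -> 0 < A ->
  4 * height X <= ln (2 * A) + height y.
Proof.
move=> x z rho0 ex ez ha hb hc hd yE A0.
have bd e0 e1 e2 e3 : (abs_sum e0 e1 e2 e3)%:R <= A ->
    (absz (cubic_form e0 e1 e2 e3 x z))%:R <= A * (mheight X)%:R ^+ 3.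
  move=> he; apply: le_trans (cubic_form_le R _ _ _ _ (leq_maxl _ _) (leq_maxr _ _)) _.
  by rewrite ler_wpM2r ?exprn_ge0 // -!natrD.
have y0 : g = 0 -> y = 0 by move=> g0; rewrite yE g0 invr0 mulr0.
have le := mheight_bezout (coprime_num_den X) rho0 ex ez (bd _ _ _ _ ha) (bd _ _ _ _ hb)
  (bd _ _ _ _ hc) (bd _ _ _ _ hd) (fun _ => yE) y0.
have posX := mheight_pos R X; have posy := mheight_pos R y.
rewrite -[4]/(4%N%:R) -(heightX R X 4) /height mheightX natrX -lnM ?posrE ?mulr_gt0 //.
by rewrite ler_ln ?posrE ?mulr_gt0 ?exprn_gt0.
Qed.

Lemma ln_pow2_le n : ln (2 ^+ n) <= n%:R :> R.
Proof. by rewrite lnXn // -[ln 2 *+ n]mulr_natl ler_piMr // ln2_le1. Qed.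

(** This is the doubling map in X = x^3/q for j = 0 (see [norm_double0]). *)
Lemma height_dup0 X :
  4 * height X <= 25 + height (X * (X - 8) ^+ 3 / (64 * (X + 1) ^+ 3)).
Proof.
set x := numq X; set z := denq X.
pose A := (4096 * 4096)%N.
have AE : A%:R = 2 ^+ 24 :> R by rewrite natrM; lra.
apply: le_trans (_ : _ <= ln (2 * A%:R) + height _) _; last first.
  by apply: lerD (lexx _); rewrite AE -exprS; apply: ln_pow2_le.
(* After the two forms and their multiplier come the cofactors for x^7, then those for z^7. The
   absolute values of each four sum to at most 2^24, so ln (2 A) <= 25. *)
apply: (@height_bezout X _ (x * (x - 8 * z) ^+ 3) (64 * z * (x + z) ^+ 3) (64 * 27 * 27 * 27) _
  (64 * 27 * 27 * 27) (64 * 2552 * 23) (64 * 128 * 457) (64 * 1024 * 19)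
  (64 * 64 * 101) (- (64 * 4096 * 14)) (64 * 4096 * 38) 0
  0 2432 (1024 * 7) (64 * 101)
  (- 38) 914 (- (11 * 667)) (27 * 27 * 27)).
- by rewrite !mulf_neq0.
- by rewrite /cubic_form -/x -/z; ring.
- by rewrite /cubic_form -/x -/z; ring.
- by rewrite ler_nat /abs_sum /A; lia.
- by rewrite ler_nat /abs_sum /A; lia.
- by rewrite ler_nat /abs_sum /A; lia.
- by rewrite ler_nat /abs_sum /A; lia.
- have z0 : (z%:~R : rat) ^+ 4 != 0 by rewrite expf_neq0 // intr_eq0 denq_neq0.
  have xE : x%:~R = X * z%:~R := numqE X.
  have -> : (x * (x - 8 * z) ^+ 3)%:~R = z%:~R ^+ 4 * (X * (X - 8) ^+ 3).
    by transitivity (x%:~R * (x%:~R - 8 * z%:~R) ^+ 3 : rat); [ring | rewrite xE; ring].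
  have -> : (64 * z * (x + z) ^+ 3)%:~R = z%:~R ^+ 4 * (64 * (X + 1) ^+ 3).
    by transitivity (64 * z%:~R * (x%:~R + z%:~R) ^+ 3 : rat); [ring | rewrite xE; ring].
  by rewrite -[RHS]mulf_div divff // mul1r.
by rewrite AE exprn_gt0.
Qed.

Lemma height_dup1728 X :
  4 * height X <= 25 + height ((X - 1) ^+ 4 / (16 * X * (X + 1) ^+ 2)).
Proof.
set x := numq X; set z := denq X.
pose A := (4096 * 4096)%N.
have AE : A%:R = 2 ^+ 24 :> R by rewrite natrM; lra.
apply: le_trans (_ : _ <= ln (2 * A%:R) + height _) _; last first.
  by apply: lerD (lexx _); rewrite AE -exprS; apply: ln_pow2_le.
apply: (@height_bezout X _ ((x - z) ^+ 4) (16 * x * z * (x + z) ^+ 2) 256 _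
  256 448 208 0 36 (- 69) 50 (- 13) 0 208 448 256 (- 13) 50 (- 69) 36).
- by [].
- by rewrite /cubic_form -/x -/z; ring.
- by rewrite /cubic_form -/x -/z; ring.
- by rewrite ler_nat /abs_sum /A; lia.
- by rewrite ler_nat /abs_sum /A; lia.
- by rewrite ler_nat /abs_sum /A; lia.
- by rewrite ler_nat /abs_sum /A; lia.
- have z0 : (z%:~R : rat) ^+ 4 != 0 by rewrite expf_neq0 // intr_eq0 denq_neq0.
  have xE : x%:~R = X * z%:~R := numqE X.
  have -> : ((x - z) ^+ 4)%:~R = z%:~R ^+ 4 * (X - 1) ^+ 4.
    by transitivity ((x%:~R - z%:~R) ^+ 4 : rat); [ring | rewrite xE; ring].
  have -> : (16 * x * z * (x + z) ^+ 2)%:~R = z%:~R ^+ 4 * (16 * X * (X + 1) ^+ 2).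
    by transitivity (16 * x%:~R * z%:~R * (x%:~R + z%:~R) ^+ 2 : rat); [ring | rewrite xE; ring].
  by rewrite -[RHS]mulf_div divff // mul1r.
by rewrite AE exprn_gt0.
Qed.

(** Meant for a form of degree k in m and n whose coefficients have absolute sum at most c;
    [hom_bound_tac] reads k and c off the expression. *)
Definition hom_bound (m n : int) k (c : nat) (a : int) :=
  (absz a <= c * maxn `|m| `|n| ^ k)%N.

Section HomBound.
Variables m n : int.
Local Notation hb := (hom_bound m n).

Lemma hom_boundM k c a k' c' a' :
  hb k c a -> hb k' c' a' -> hb (k + k')%N (c * c')%N (a * a').
Proof. by rewrite /hom_bound abszM expnD => h h'; rewrite mulnACA leq_mul. Qed.

Lemma hom_boundD k c c' a a' : hb k c a -> hb k c' a' -> hb k (c + c')%N (a + a').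
Proof. by rewrite /hom_bound mulnDl => h h'; have := leq_add h h'; lia. Qed.

Lemma hom_boundN k c a : hb k c a -> hb k c (- a).
Proof. by rewrite /hom_bound abszN. Qed.

Lemma hom_boundC (c : nat) : hb 0 c c%:R.
Proof. by rewrite /hom_bound muln1 natz absz_nat. Qed.

Lemma hom_bound0 : hb 0 0 0.
Proof. by []. Qed.

Lemma hom_boundl : hb 1 1 m.
Proof. by rewrite /hom_bound mul1n leq_maxl. Qed.

Lemma hom_boundr : hb 1 1 n.
Proof. by rewrite /hom_bound mul1n leq_maxr. Qed.

End HomBound.

Ltac hom_bound_tac :=
  match goal with
  | |- is_true (hom_bound _ _ _ _ 0) => eapply hom_bound0
  | |- is_true (hom_bound _ _ _ _ (- _)) => eapply hom_boundN; hom_bound_tac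
  | |- is_true (hom_bound _ _ _ _ (_ * _)) => eapply hom_boundM; [hom_bound_tac | hom_bound_tac]
  | |- is_true (hom_bound _ _ _ _ (_ + _)) => eapply hom_boundD; [hom_bound_tac | hom_bound_tac]
  | |- is_true (hom_bound ?m _ _ _ ?m) => eapply hom_boundl
  | |- is_true (hom_bound _ ?n _ _ ?n) => eapply hom_boundr
  | |- is_true (hom_bound _ _ _ _ ?c) => eapply hom_boundC
  end.

(** In X = x p/q the curve is a twist of y^2 = x^3 + t x + t with t = p^3/q^2, whose discriminant is
    t^2 (4 t + 27) up to a constant. Writing t = m/n and clearing denominators, the cofactors have
    degree 5 in m and n; hence the term 5 h(t). *)
Lemma height_dup_generic t X : t != 0 -> 4 * t + 27 != 0 ->
  4 * height X <= 25 + 5 * height t +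
    height ((X ^+ 4 - 2 * t * X ^+ 2 - 8 * t * X + t ^+ 2)
      / (4 * (X ^+ 3 + t * X + t))).
Proof.
move=> t0 D0.
set x := numq X; set z := denq X; set m := numq t; set n := denq t.
pose mu := mheight t; pose A := ((4096 * 4096) * mu ^ 5)%N.
have mu0 : (0 < mu)%N by apply: mheight_gt0.
have A0 : 0 < A%:R :> R by rewrite ltr0n muln_gt0 expn_gt0 mu0.
have lnA : ln (2 * A%:R) <= 25 + 5 * height t :> R.
  have -> : 2 * A%:R = 2 ^+ 25 * mu%:R ^+ 5 :> R by rewrite /A (natrM _ (4096 * 4096)%N) natrM natrX; ring.
  rewrite lnM ?posrE ?exprn_gt0 ?ltr0n // [X in _ + X]lnXn ?ltr0n //.
  rewrite -[_ *+ 5]mulr_natl lerD //; exact: ln_pow2_le.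
apply: le_trans (lerD lnA (lexx _)).
have sumA k0 k1 k2 k3 c0 c1 c2 c3 a0 a1 a2 a3 :
    hom_bound m n k0 c0 a0 -> hom_bound m n k1 c1 a1 ->
    hom_bound m n k2 c2 a2 -> hom_bound m n k3 c3 a3 ->
    [&& k0 <= 5, k1 <= 5, k2 <= 5, k3 <= 5 & c0 + c1 + c2 + c3 <= 4096]%N ->
    (abs_sum a0 a1 a2 a3)%:R <= A%:R :> R.
  rewrite /hom_bound ler_nat /abs_sum => h0 h1 h2 h3 /and5P[e0 e1 e2 e3 hc].
  have le5 k c a : (absz a <= c * mu ^ k -> k <= 5 -> absz a <= c * mu ^ 5)%N.
    by move=> h k5; apply: leq_trans h _; rewrite leq_mul // leq_pexp2l.
  apply: (@leq_trans (4096 * mu ^ 5)); last by rewrite /A -mulnA leq_pmull.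
  apply: leq_trans (leq_mul hc (leqnn (mu ^ 5))).
  rewrite !mulnDl !leq_add //.
  - exact: le5 h0 e0.
  - exact: le5 h1 e1.
  - exact: le5 h2 e2.
  - exact: le5 h3 e3.
apply: (@height_bezout X _
  (n ^+ 2 * x ^+ 4 - 2 * m * n * x ^+ 2 * z ^+ 2 - 8 * m * n * x * z ^+ 3 + m ^+ 2 * z ^+ 4)
  (4 * z * (n ^+ 2 * x ^+ 3 + m * n * x * z ^+ 2 + m * n * z ^+ 3))
  (4 * m * m * (4 * m + 27 * n) * (n * n * n * n)) _
  (m * m * (4 * (4 * m + 27 * n) * n * n)) (m * m * (- (4 * m * n * n)))
  (m * m * (4 * m * (3 * m + 22 * n) * n)) (m * m * (12 * m * (8 * n + m) * n))
  (m * m * (m * n * n)) (m * m * (m * (5 * m + 32 * n) * n))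
  (m * m * (2 * m * (13 * m + 96 * n) * n)) (m * m * (- (3 * m * m * (8 * n + m))))
  0 (12 * n * n * n * n * n) 0 (16 * m * n * n * n * n)
  (- (3 * n * n * n * n * n)) 0 (5 * m * n * n * n * n) (27 * m * n * n * n * n)).
- rewrite !mulf_neq0 ?denq_neq0 ?numq_eq0 //.
  apply: contra_neq D0 => D0; rewrite -(divq_num_den t) -/m -/n.
  have n0 : (n%:~R : rat) != 0 by rewrite intr_eq0 denq_neq0.
  apply: (mulfI n0); rewrite mulr0.
  transitivity ((4 * m + 27 * n)%:~R : rat); last by rewrite D0.
  by rewrite intrD !intrM; field.
- by rewrite /cubic_form -/x -/z; ring.
- by rewrite /cubic_form -/x -/z; ring.
- by eapply sumA; [hom_bound_tac | hom_bound_tac | hom_bound_tac | hom_bound_tac | ].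
- by eapply sumA; [hom_bound_tac | hom_bound_tac | hom_bound_tac | hom_bound_tac | ].
- by eapply sumA; [hom_bound_tac | hom_bound_tac | hom_bound_tac | hom_bound_tac | ].
- by eapply sumA; [hom_bound_tac | hom_bound_tac | hom_bound_tac | hom_bound_tac | ].
- have z0 : (z%:~R : rat) ^+ 4 != 0 by rewrite expf_neq0 // intr_eq0 denq_neq0.
  have n0 : (n%:~R : rat) ^+ 2 != 0 by rewrite expf_neq0 // intr_eq0 denq_neq0.
  have xE : x%:~R = X * z%:~R := numqE X.
  have mE : m%:~R = t * n%:~R := numqE t.
  set f := (X in _ = X%:~R / _); set g := (X in _ = _ / X%:~R).
  have -> : f%:~R = n%:~R ^+ 2 * z%:~R ^+ 4 *
      (X ^+ 4 - 2 * t * X ^+ 2 - 8 * t * X + t ^+ 2).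
    transitivity (n%:~R ^+ 2 * x%:~R ^+ 4 - 2 * m%:~R * n%:~R * x%:~R ^+ 2 * z%:~R ^+ 2
      - 8 * m%:~R * n%:~R * x%:~R * z%:~R ^+ 3 + m%:~R ^+ 2 * z%:~R ^+ 4 : rat).
      by rewrite /f; ring.
    by rewrite xE mE; ring.
  have -> : g%:~R = n%:~R ^+ 2 * z%:~R ^+ 4 * (4 * (X ^+ 3 + t * X + t)).
    transitivity (4 * z%:~R * (n%:~R ^+ 2 * x%:~R ^+ 3 + m%:~R * n%:~R * x%:~R * z%:~R ^+ 2
      + m%:~R * n%:~R * z%:~R ^+ 3) : rat).
      by rewrite /g; ring.
    by rewrite xE mE; ring.
  by rewrite -[RHS]mulf_div (divff (mulf_neq0 n0 z0)) mul1r.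
by [].
Qed.
End Duplication.

(** * Addition in coordinates divided by the abscissa of one summand *)

Section ScaledCalculus.
Variable R : realType.
Local Notation height := (height R).

(** The cross term w = y1 y2/u1^3 is controlled through its square, a product of two values of the
    cubic. *)
Lemma height_add_scaled (p q r w s : rat) (M : R) :
  1 <= M -> height p <= 70 * M -> height q <= 70 * M -> height r <= M ->
  w ^+ 2 = (1 + p + q) * (r ^+ 3 + p * r + q) ->
  s = ((1 + p + q) + (r ^+ 3 + p * r + q) - 2 * w) / (r - 1) ^+ 2 - 1 - r ->
  height s <= 450 * M.
Proof.
move=> M1 hp hq hr ew ->.
set F1 := 1 + p + q in ew *; set F2 := r ^+ 3 + p * r + q in ew *.
have hF1 : height F1 <= 142 * M.
  by have := heightD R (1 + p) q; have := heightD R 1 p; rewrite height1; lra.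
have hF2 : height F2 <= 147 * M.
  have := heightD R (r ^+ 3 + p * r) q; have := heightD R (r ^+ 3) (p * r).
  by have := heightM R p r; rewrite heightX; lra.
have hw : height w <= 145 * M.
  by have := heightM R F1 F2; rewrite -ew heightX; lra.
have := heightB R ((F1 + F2 - 2 * w) / (r - 1) ^+ 2 - 1) r.
have := heightB R ((F1 + F2 - 2 * w) / (r - 1) ^+ 2) 1.
have := heightF R (F1 + F2 - 2 * w) ((r - 1) ^+ 2).
have := heightB R (F1 + F2) (2 * w); have := heightD R F1 F2.
have := heightM R 2 w; have := height_nat R 2; have := heightB R r 1.
by rewrite heightX height1; lra.
Qed.

Lemma height_double_scaled (p q s : rat) (M : R) :
  1 <= M -> height p <= 70 * M -> height q <= 70 * M ->
  s = (3 + p) ^+ 2 / (4 * (1 + p + q)) - 2 -> height s <= 450 * M.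
Proof.
move=> M1 hp hq ->.
have := heightB R ((3 + p) ^+ 2 / (4 * (1 + p + q))) 2.
have := heightF R ((3 + p) ^+ 2) (4 * (1 + p + q)).
have := heightM R 4 (1 + p + q); have := heightD R (1 + p) q.
have := heightD R 1 p; have := heightD R 3 p.
have := height_nat R 2; have := height_nat R 3; have := height_nat R 4.
by rewrite heightX height1; lra.
Qed.

End ScaledCalculus.

(** A twist multiplies u, p, q, y^2 by c, c^2, c^3, c^3; so p', q', r and w are invariant, and they
    suffice to express the new abscissa relative to u1. *)
Lemma scaled_add (p q u1 u2 y1 y2 l : rat) : u1 != 0 -> u1 != u2 ->
  y1 ^+ 2 = u1 ^+ 3 + p * u1 + q -> y2 ^+ 2 = u2 ^+ 3 + p * u2 + q ->
  y2 = y1 + l * (u2 - u1) ->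
  let p' := p / u1 ^+ 2 in let q' := q / u1 ^+ 3 in let r := u2 / u1 in
  let w := y1 * y2 / u1 ^+ 3 in
  w ^+ 2 = (1 + p' + q') * (r ^+ 3 + p' * r + q') /\
  (l ^+ 2 - u1 - u2) / u1 =
    ((1 + p' + q') + (r ^+ 3 + p' * r + q') - 2 * w) / (r - 1) ^+ 2 - 1 - r.
Proof.
move=> u0 u12 e1 e2 ey p' q' r w.
have d0 : u2 - u1 != 0 by rewrite subr_eq0 eq_sym.
have -> : 1 + p' + q' = y1 ^+ 2 / u1 ^+ 3 by rewrite e1 /p' /q'; field.
have -> : r ^+ 3 + p' * r + q' = y2 ^+ 2 / u1 ^+ 3 by rewrite e2 /p' /q' /r; field.
split; first by rewrite /w; field.
by rewrite /w /r ey; field; rewrite u0 mulN1r d0.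
Qed.

Lemma scaled_double (p q u1 y1 l : rat) : u1 != 0 -> y1 != 0 ->
  y1 ^+ 2 = u1 ^+ 3 + p * u1 + q -> 2 * y1 * l = 3 * u1 ^+ 2 + p ->
  (l ^+ 2 - u1 - u1) / u1 =
    (3 + p / u1 ^+ 2) ^+ 2 / (4 * (1 + p / u1 ^+ 2 + q / u1 ^+ 3)) - 2.
Proof.
move=> u0 y0 e1 el.
have -> : 1 + p / u1 ^+ 2 + q / u1 ^+ 3 = y1 ^+ 2 / u1 ^+ 3 by rewrite e1; field.
have -> : 3 + p / u1 ^+ 2 = 2 * y1 * l / u1 ^+ 2 by rewrite el; field.
by field; rewrite u0 y0.
Qed.

Definition double_x (p q u : rat) : rat :=
  (u ^+ 4 - 2 * p * u ^+ 2 - 8 * q * u + p ^+ 2) / (4 * (u ^+ 3 + p * u + q)).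

Lemma double_xE (p q u y l : rat) : y != 0 ->
  y ^+ 2 = u ^+ 3 + p * u + q -> 2 * y * l = 3 * u ^+ 2 + p ->
  l ^+ 2 - u - u = double_x p q u.
Proof.
move=> y0 e el; rewrite /double_x -e.
have -> : u ^+ 4 - 2 * p * u ^+ 2 - 8 * q * u + p ^+ 2 =
    (3 * u ^+ 2 + p) ^+ 2 - 8 * u * (u ^+ 3 + p * u + q) by ring.
by rewrite -e -el; field.
Qed.

(** Division by zero yields 0. This suits points of order 2: their double is the point at infinity,
    whose height is set to 0, the height of the rational 0. *)
Lemma double_x_root (p q u : rat) : u ^+ 3 + p * u + q = 0 -> double_x p q u = 0.
Proof. by rewrite /double_x => ->; rewrite mulr0 invr0 mulr0. Qed.

Lemma norm_double0 (q u : rat) : q != 0 -> let X := u ^+ 3 / q in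
  double_x 0 q u ^+ 3 / q = X * (X - 8) ^+ 3 / (64 * (X + 1) ^+ 3).
Proof.
move=> q0 X; have XE : X + 1 = (u ^+ 3 + 0 * u + q) / q by rewrite /X; field.
have [v0|v0] := eqVneq (u ^+ 3 + 0 * u + q) 0.
  have z3 : (0 : rat) ^+ 3 = 0 by rewrite expr0n.
  by rewrite double_x_root // XE v0 mul0r z3 mulr0 invr0 mulr0.
rewrite XE /double_x /X; field; rewrite q0 /=.
by move: v0; rewrite mul0r addr0.
Qed.

Lemma norm_double1728 (p u : rat) : p != 0 -> let X := u ^+ 2 / p in
  double_x p 0 u ^+ 2 / p = (X - 1) ^+ 4 / (16 * X * (X + 1) ^+ 2).
Proof.
move=> p0 X.
have XE : 16 * X * (X + 1) ^+ 2 = 16 * (u ^+ 3 + p * u + 0) ^+ 2 / p ^+ 3.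
  by rewrite /X; field.
have [v0|v0] := eqVneq (u ^+ 3 + p * u + 0) 0.
  have z2 : (0 : rat) ^+ 2 = 0 by rewrite expr0n.
  by rewrite double_x_root // XE v0 z2 mulr0 !mul0r invr0 mulr0.
rewrite XE /double_x /X; field; rewrite p0 /=.
by move: v0; rewrite addr0.
Qed.

Lemma norm_double_generic (p q u : rat) : p != 0 -> q != 0 ->
  let X := p / q * u in let t := p ^+ 3 / q ^+ 2 in
  p / q * double_x p q u =
    (X ^+ 4 - 2 * t * X ^+ 2 - 8 * t * X + t ^+ 2) / (4 * (X ^+ 3 + t * X + t)).
Proof.
move=> p0 q0 X t.
have XE : X ^+ 3 + t * X + t = p ^+ 3 / q ^+ 3 * (u ^+ 3 + p * u + q).
  by rewrite /X /t; field.
have [v0|v0] := eqVneq (u ^+ 3 + p * u + q) 0.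
  by rewrite double_x_root // XE v0 !mulr0 invr0 mulr0.
by rewrite XE /double_x /X /t; field; rewrite q0 p0 v0.
Qed.

(** * Heights on elliptic curves *)

(** Solving for p^3/q^2 gives (27/4) j/(12^3 - j), where j differs from 12^3 because q is
    nonzero. *)
Lemma height_tau (R : realType) (p q j : rat) :
  p != 0 -> q != 0 -> j * (4 * p ^+ 3 + 27 * q ^+ 2) = 12 ^+ 3 * (4 * p ^+ 3) ->
  height R (p ^+ 3 / q ^+ 2) <= 70 * (1 + height R j).
Proof.
have hc : height R (12 ^+ 3) <= 36.
  by rewrite heightX; have := height_nat R 12; lra.
have : (12 : rat) ^+ 3 != 0 by rewrite expf_neq0.
move: (12 ^+ 3) hc => c hc c0 p0 q0 jE.
have pq : p ^+ 3 * (c - j) = 27 / 4 * (j * q ^+ 2).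
  have n4 : (4 : rat) != 0 by [].
  apply: (mulfI n4); transitivity (c * (4 * p ^+ 3) - 4 * (j * p ^+ 3)); first by ring.
  by rewrite -jE; field.
have j1 : c - j != 0.
  apply: contra_neq q0 => e; move/eqP: e; rewrite subr_eq0 => /eqP e.
  move: jE; rewrite -e => /(mulfI c0) h.
  have /eqP : 27 * q ^+ 2 = 0 by apply: (addrI (4 * p ^+ 3)); rewrite h addr0.
  by rewrite mulf_eq0 (negPf (_ : 27 != 0)) // sqrf_eq0 => /eqP.
have -> : p ^+ 3 / q ^+ 2 = 27 / 4 * (j / (c - j)).
  have -> : p ^+ 3 = 27 / 4 * (j * q ^+ 2) / (c - j) by rewrite -pq mulfK.
  by field; rewrite j1 q0.
have := heightM R (27 / 4) (j / (c - j)); have := heightF R 27 4.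
have := heightF R j (c - j); have := heightB R c j.
have := height_nat R 27; have := height_nat R 4; have := height_ge0 R j.
by lra.
Qed.

Section CurveHeight.
Variables (R : realType) (E : elliptic_curve).
Local Notation height := (height R).

(** Together with the next two, the depressed form y^2 = u^3 + p u + q with u = x + a/3. *)
Definition dep_p : rat := wb E - wa E ^+ 2 / 3.
Definition dep_q : rat := wc E - wa E * wb E / 3 + 2 * wa E ^+ 3 / 27.
Definition dep_x (x : rat) : rat := x + wa E / 3.
Local Notation p := dep_p.
Local Notation q := dep_q.
Local Notation u := dep_x.

Lemma on_curve_dep x y :
  on_curve E (Some (x, y)) -> y ^+ 2 = u x ^+ 3 + p * u x + q.
Proof. by move=> /eqP ->; rewrite /dep_x /dep_p /dep_q; field. Qed.

Lemma disc_dep : disc (wa E) (wb E) (wc E) = - (4 * p ^+ 3 + 27 * q ^+ 2).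
Proof. by rewrite /disc /dep_p /dep_q; field. Qed.

Lemma disc_dep_neq0 : 4 * p ^+ 3 + 27 * q ^+ 2 != 0.
Proof. by have := disc_neq0 E; rewrite disc_dep oppr_eq0. Qed.

Definition hj : R := 1 + height (j_invariant E).

Lemma hj_ge1 : 1 <= hj.
Proof. by rewrite /hj lerDl height_ge0. Qed.

Lemma height_pq : p != 0 -> q != 0 -> height (p ^+ 3 / q ^+ 2) <= 70 * hj.
Proof.
move=> p0 q0; have D0 := disc_dep_neq0.
apply: height_tau => //; rewrite /j_invariant disc_dep.
have -> : wa E ^+ 2 - 3 * wb E = - 3 * p by rewrite /dep_p; field.
by field; rewrite D0.
Qed.

(* The normalisation of [x] is invariant under twists: it is x^3/q if j = 0,
   x^2/p if j = 1728, and x p/q otherwise. *)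
Definition norm_scale : rat :=
  if p == 0 then q^-1 else if q == 0 then p^-1 else p / q.
Definition norm_exp : nat := if p == 0 then 3 else if q == 0 then 2 else 1.
Definition norm_x x := norm_scale * u x ^+ norm_exp.

Lemma norm_scale_neq0 : norm_scale != 0.
Proof.
have D0 := disc_dep_neq0; rewrite /norm_scale; case: (eqVneq p 0) D0 => [->|p0].
  rewrite expr0n mulr0 add0r mulf_eq0 negb_or sqrf_eq0 => /andP[_ q0].
  by rewrite invr_eq0.
by case: (eqVneq q 0) => [_|q0] _; rewrite ?invr_eq0 // mulf_neq0 // invr_eq0.
Qed.

Lemma norm_exp_bounds : (1 <= norm_exp <= 3)%N.
Proof. by rewrite /norm_exp; case: (p == 0) (q == 0) => [] []. Qed.

(** The factor [norm_scale] cancels in the quotient, leaving a power of u x1/u x2 with exponent at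
    least 1. *)
Lemma height_ratio x1 x2 :
  height (u x1 / u x2) <= height (norm_x x1) + height (norm_x x2).
Proof.
have := heightF R (norm_x x1) (norm_x x2).
have -> : norm_x x1 / norm_x x2 = (u x1 / u x2) ^+ norm_exp.
  by rewrite /norm_x -mulf_div divff ?norm_scale_neq0 // mul1r expr_div_n.
rewrite heightX; apply: le_trans; rewrite ler_peMl ?height_ge0 //.
by rewrite ler1n; case/andP: norm_exp_bounds.
Qed.

Lemma height_norm_x x1 x2 : u x2 != 0 ->
  height (norm_x x1) <= height (norm_x x2) + 3 * height (u x1 / u x2).
Proof.
move=> u0; have -> : norm_x x1 = norm_x x2 * (u x1 / u x2) ^+ norm_exp.
  by rewrite /norm_x -mulrA -exprMn mulrCA divff // mulr1.
apply: le_trans (heightM _ _ _) _; rewrite lerD2l heightX ler_wpM2r ?height_ge0 //.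
by rewrite ler_nat; case/andP: norm_exp_bounds.
Qed.

(** With X = [norm_x x] and t = p^3/q^2, the quotient is 0, 1/X or t/X^2 according as p = 0, q = 0
    or neither. For q/u^3 the values are 1/X, 0 and t/X^3. *)
Lemma height_scaled_p x : u x != 0 ->
  height (p / u x ^+ 2) <= 2 * height (norm_x x) + 70 * hj.
Proof.
have hj1 := hj_ge1; have h0 := height_ge0 R (norm_x x).
move=> u0; have [p0|p0] := eqVneq p 0; first by rewrite p0 mul0r height0; lra.
have [q0|q0] := eqVneq q 0.
  have -> : p / u x ^+ 2 = (norm_x x)^-1.
    by rewrite /norm_x /norm_scale /norm_exp (negPf p0) q0 eqxx; field; rewrite u0 p0.
  by rewrite heightV; lra.
have -> : p / u x ^+ 2 = p ^+ 3 / q ^+ 2 / norm_x x ^+ 2.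
  rewrite /norm_x /norm_scale /norm_exp (negPf p0) (negPf q0); field.
  by rewrite u0 p0 q0.
have := heightF R (p ^+ 3 / q ^+ 2) (norm_x x ^+ 2); have := height_pq p0 q0.
by rewrite heightX; lra.
Qed.

Lemma height_scaled_q x : u x != 0 ->
  height (q / u x ^+ 3) <= 3 * height (norm_x x) + 70 * hj.
Proof.
have hj1 := hj_ge1; have h0 := height_ge0 R (norm_x x).
move=> u0; have [q0|q0] := eqVneq q 0; first by rewrite q0 mul0r height0; lra.
have [p0|p0] := eqVneq p 0.
  have -> : q / u x ^+ 3 = (norm_x x)^-1.
    by rewrite /norm_x /norm_scale /norm_exp p0 eqxx; field; rewrite u0 q0.
  by rewrite heightV; lra.
have -> : q / u x ^+ 3 = p ^+ 3 / q ^+ 2 / norm_x x ^+ 3.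
  rewrite /norm_x /norm_scale /norm_exp (negPf p0) (negPf q0); field.
  by rewrite u0 p0 q0.
have := heightF R (p ^+ 3 / q ^+ 2) (norm_x x ^+ 3); have := height_pq p0 q0.
by rewrite heightX; lra.
Qed.

Lemma chord_dep_x x1 y1 x2 y2 l x3 : chord E x1 y1 x2 y2 l x3 ->
  u x3 = l ^+ 2 - u x1 - u x2.
Proof.
case=> _ ea _ _; have -> : l ^+ 2 = wa E + x1 + x2 + x3 by rewrite {1}ea; ring.
by rewrite /dep_x; field.
Qed.

Lemma chord_tangent x y l x3 : chord E x y x y l x3 -> 2 * y * l = 3 * u x ^+ 2 + p.
Proof.
case=> _ ea eb _; have el : l ^+ 2 = wa E + x + x + x3 by rewrite {1}ea; ring.
have -> : 2 * y * l = wb E + 2 * x * l ^+ 2 - x ^+ 2 - 2 * x * x3.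
  by rewrite {1}eb; ring.
by rewrite el /dep_x /dep_p; field.
Qed.

Lemma chord_sym x1 y1 x2 y2 l x3 :
  chord E x1 y1 x2 y2 l x3 -> chord E x2 y2 x1 y1 l x3.
Proof.
by case=> e2 ea eb ec; split; rewrite ?ea ?eb ?ec ?e2; ring.
Qed.

Definition pt_height (P : Defs.point) : R :=
  if P is Some (x, _) then height (norm_x x) else 0.

Lemma pt_height_ge0 P : 0 <= pt_height P.
Proof. by case: P => [[x y]|] //=; apply: height_ge0. Qed.

Lemma pt_height_neg P : pt_height (negp P) = pt_height P.
Proof. by case: P => [[x y]|]. Qed.

Lemma height_chord x1 y1 x2 y2 l x3 :
  on_curve E (Some (x1, y1)) -> on_curve E (Some (x2, y2)) ->
  chord E x1 y1 x2 y2 l x3 -> (x1 = x2 -> y1 = y2 /\ y1 != 0) -> u x1 != 0 ->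
  height (norm_x x3) <= 1400 * (height (norm_x x1) + height (norm_x x2) + hj).
Proof.
move=> on1 on2 c eq12 u0; have e1 := on_curve_dep on1; have e2 := on_curve_dep on2.
set M := _ + hj; have hj1 := hj_ge1.
have n1 := height_ge0 R (norm_x x1); have n2 := height_ge0 R (norm_x x2).
have M1 : 1 <= M by rewrite /M; lra.
have hp : height (p / u x1 ^+ 2) <= 70 * M.
  by have := height_scaled_p u0; rewrite /M; lra.
have hq : height (q / u x1 ^+ 3) <= 70 * M.
  by have := height_scaled_q u0; rewrite /M; lra.
suff : height (u x3 / u x1) <= 450 * M.
  by have := height_norm_x x3 u0; rewrite /M; lra.
rewrite (chord_dep_x c); have [ex|nx] := eqVneq x1 x2.
  have [ey y0] := eq12 ex; rewrite -{}ex -{}ey in c *.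
  apply: (height_double_scaled M1 hp hq).
  exact: scaled_double u0 y0 e1 (chord_tangent c).
have nu : u x1 != u x2 by rewrite /dep_x (inj_eq (addIr _)).
have ey : y2 = y1 + l * (u x2 - u x1).
  by case: c => -> _ _ _; rewrite /dep_x; ring.
have [ew es] := scaled_add u0 nu e1 e2 ey.
apply: (height_add_scaled M1 hp hq _ ew es).
by have := height_ratio x2 x1; rewrite /M; lra.
Qed.

Lemma pt_height_add P Q : on_curve E P -> on_curve E Q ->
  pt_height (addp E P Q) <= 1400 * (pt_height P + pt_height Q + hj).
Proof.
have hj1 := hj_ge1.
case: P => [[x1 y1]|] on1; last first.
  by move=> _; rewrite [pt_height None]/=; have := pt_height_ge0 Q; change (addp E None Q) with Q; lra.
case: Q => [[x2 y2]|] on2; last first.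
  by rewrite addp0 /pt_height; have := height_ge0 R (norm_x x1); lra.
have n1 := height_ge0 R (norm_x x1); have n2 := height_ge0 R (norm_x x2).
have [opp|opp] := boolP (opposite x1 y1 x2 y2).
  by move: opp; rewrite (opposite_addp E) => /eqP->; rewrite /pt_height; lra.
have [l [x3 c]] := chordP on1 on2 opp; rewrite (addp_chord opp c) /pt_height.
have eq12 : x1 = x2 -> y1 = y2 /\ y1 != 0.
  move=> ex; move: opp; rewrite /opposite ex eqxx /= => s0.
  have e1 := on_curve_dep on1; have e2 := on_curve_dep on2.
  have /eqP : (y1 - y2) * (y1 + y2) = 0 by rewrite -subr_sqr e1 e2 ex subrr.
  rewrite mulf_eq0 subr_eq0 addr_eq0 (negPf s0) orbF => /eqP ey; split=> //.
  by apply: contraNneq s0 => y0; rewrite -ey y0 oppr0.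
have [u10|u10] := eqVneq (u x1) 0; last exact: height_chord on1 on2 c eq12 u10.
have [u20|u20] := eqVneq (u x2) 0; last first.
  rewrite (addrC (height (norm_x x1))).
  apply: (height_chord on2 on1 (chord_sym c) _ u20) => ex.
  by have [ey y0] := eq12 (esym ex); rewrite -ey.
(* Neither abscissa can serve as unit, so the sum is the double of a point with u = 0, whose
   abscissa is p^2/(4 q) explicitly; its normalisation is 0 or t/4 with t = p^3/q^2. *)
have ex : x1 = x2 by apply: (addIr (wa E / 3)); rewrite -/(u x1) -/(u x2) u10 u20.
have [ey y0] := eq12 ex; subst x2 y2.
have e1 := on_curve_dep on1; have tg := chord_tangent c.
have -> : norm_x x3 = norm_scale * double_x p q 0 ^+ norm_exp.
  by rewrite /norm_x (chord_dep_x c) (double_xE y0 e1 tg) u10.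
have dE : double_x p q 0 = p ^+ 2 / (4 * q).
  rewrite /double_x !expr0n /= !mulr0 !subr0 !add0r //.
have q0 : q != 0.
  by apply: contraNneq y0 => q0; rewrite -sqrf_eq0 e1 u10 q0 expr0n mulr0 !addr0.
rewrite dE /norm_scale /norm_exp (negPf q0); case: eqVneq => p0.
  by rewrite p0 expr0n mul0r expr0n mulr0 height0; lra.
have -> : p / q * (p ^+ 2 / (4 * q)) ^+ 1 = p ^+ 3 / q ^+ 2 / 4 by field.
have := height_pq p0 q0; have := heightF R (p ^+ 3 / q ^+ 2) 4.
by have := height_nat R 4; lra.
Qed.

Lemma pt_height_double P : on_curve E P ->
  4 * pt_height P <= pt_height (addp E P P) + 400 * hj.
Proof.
have hj1 := hj_ge1.
case: P => [[x y]|] on1; last by rewrite /pt_height /=; lra.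
have -> : pt_height (addp E (Some (x, y)) (Some (x, y))) =
    height (norm_scale * double_x p q (u x) ^+ norm_exp).
  have e1 := on_curve_dep on1.
  have [y0|y0] := eqVneq y 0.
    have -> : addp E (Some (x, y)) (Some (x, y)) = None.
      by apply/eqP; rewrite -opposite_addp /opposite y0 oppr0 !eqxx.
    rewrite double_x_root -?e1 ?y0 ?expr0n //.
    by case: norm_exp norm_exp_bounds => // n _; rewrite mulr0 height0.
  have opp : ~~ opposite x y x y.
    rewrite /opposite eqxx /= -addr_eq0 -mulr2n -mulr_natl mulf_eq0 negb_or y0 andbT //.
  have [l [x3 c]] := chordP on1 on1 opp; rewrite (addp_chord opp c) /pt_height.
  by rewrite /norm_x (chord_dep_x c) (double_xE y0 e1 (chord_tangent c)).
rewrite /pt_height /norm_x /norm_scale /norm_exp.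
have D0 := disc_dep_neq0.
have [p0|p0] := eqVneq p 0.
  have q0 : q != 0.
    by apply: contraNneq D0 => q0; rewrite p0 q0 !expr0n !mulr0 addr0.
  rewrite p0 ![q^-1 * _]mulrC (norm_double0 _ q0).
  by have := height_dup0 R (u x ^+ 3 / q); lra.
have [q0|q0] := eqVneq q 0.
  rewrite q0 ![p^-1 * _]mulrC (norm_double1728 _ p0).
  by have := height_dup1728 R (u x ^+ 2 / p); lra.
rewrite !expr1 (norm_double_generic _ p0 q0).
have t0 : p ^+ 3 / q ^+ 2 != 0 by rewrite mulf_neq0 ?invr_eq0 ?expf_neq0.
have t27 : 4 * (p ^+ 3 / q ^+ 2) + 27 != 0.
  apply: contraNneq D0 => e; have -> : 4 * p ^+ 3 + 27 * q ^+ 2 =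
    (4 * (p ^+ 3 / q ^+ 2) + 27) * q ^+ 2 by field.
  by rewrite e mul0r.
(* The loss is 25 + 5 * 70 hj, at most 400 hj. *)
have := height_dup_generic R (p / q * u x) t0 t27; have := height_pq p0 q0.
by lra.
Qed.

End CurveHeight.

(** * Counting points *)

(** Each root of Q is the abscissa of at most two points, P and -P. *)
Lemma size_points_root (E : elliptic_curve) (Q : {poly rat}) (S : seq (curve_pt E)) :
  Q != 0 -> uniq S ->
  (forall P, P \in S -> exists x y, val P = Some (x, y) /\ root Q x) ->
  (size S <= (size Q).-1 * 2)%N.
Proof.
move=> Q0 US hS; pose xc (P : curve_pt E) := if val P is Some (x, _) then x else 0.
have szx : (size (undup (map xc S)) <= (size Q).-1)%N.
  rewrite -ltnS prednK ?size_poly_gt0 //; apply: max_poly_roots (undup_uniq _) => //.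
  apply/allP => x; rewrite mem_undup => /mapP[P /hS [x' [y [e r]]] ->].
  by rewrite /xc e.
apply: leq_trans (leq_mul szx (leqnn 2)); apply: (@size_le_fibers _ _ xc).
  by move=> P PS; rewrite mem_undup map_f.
move=> x; rewrite -size_filter; set S' := [seq _ <- _ | _].
have US' : uniq S' by apply: filter_uniq.
have mS' P : P \in S' -> exists y, val P = Some (x, y).
  rewrite mem_filter => /andP[/eqP <- /hS [x' [y [e _]]]].
  by exists y; rewrite /xc e.
case eS : S' => [//|P S'']; rewrite -eS.
have [y eP] : exists y, val P = Some (x, y) by apply: mS'; rewrite eS mem_head.
apply: (@uniq_leq_size _ _ [:: P; - P]) => // P' /mS' [y' eP'].
have := valP P; have := valP P'; rewrite /= eP eP' => /eqP e1 /eqP e2.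
have : (y' - y) * (y' + y) = 0 by rewrite -subr_sqr e1 e2 subrr.
move/eqP; rewrite mulf_eq0 subr_eq0 addr_eq0 !inE => /orP[] /eqP ey.
  by apply/orP; left; apply/eqP/val_inj; rewrite eP eP' ey.
by apply/orP; right; apply/eqP/val_inj; rewrite val_curveN eP eP' ey.
Qed.

Definition rationals_upto (T : nat) : seq rat :=
  [seq (i%:Z - T%:Z)%:~R / (j%:Z)%:~R | i <- iota 0 (2 * T).+1, j <- iota 1 T].

Lemma size_rationals_upto T : (0 < T)%N -> (size (rationals_upto T) <= 3 * T ^ 2)%N.
Proof. by move=> T0; rewrite size_allpairs !size_iota; nia. Qed.

Lemma mem_rationals_upto T x : (mheight x <= T)%N -> x \in rationals_upto T.
Proof.
rewrite geq_max => /andP[hn hd]; have := denq_gt0 x.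
move: (divq_num_den x) hn hd; move: (numq x) (denq x) => n d <- hn hd d0.
have in1 : absz (n + T%:Z) \in iota 0 (2 * T).+1 by rewrite mem_iota; lia.
have in2 : absz d \in iota 1 T by rewrite mem_iota; lia.
apply/allpairsP; exists (absz (n + T%:Z), absz d); split => //=.
have -> : (absz (n + T%:Z))%:Z - T%:Z = n by lia.
by have -> : (absz d)%:Z = d by lia.
Qed.

Section Counting.
Variables (R : realType) (E : elliptic_curve).
Local Notation u := (dep_x E).
Local Notation p := (dep_p E).
Local Notation q := (dep_q E).
Local Notation curve := (curve_pt E).

Definition cheight (P : curve) : R := pt_height R E (val P).

Let affine_linear : {poly rat} := 'X - (- (wa E / 3))%:P.

Let affine_linearE x : affine_linear.[x] = u x.
Proof. by rewrite hornerXsubC opprK. Qed.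

Let affine_linear_size : size affine_linear = 2.
Proof. by rewrite size_XsubC. Qed.

Let norm_x_fiber (S : seq curve) c : uniq S ->
  (forall P, P \in S -> exists x y, val P = Some (x, y) /\ norm_x E x = c) ->
  (size S <= 6)%N.
Proof.
move=> US hS; pose Q := norm_scale E *: affine_linear ^+ norm_exp E - c%:P.
have szQ : size Q = (norm_exp E).+1.
  have sz1 : size (norm_scale E *: affine_linear ^+ norm_exp E) = (norm_exp E).+1.
    by rewrite size_scale ?norm_scale_neq0 // size_exp_XsubC.
  rewrite size_polyDl sz1 // size_polyN; apply: leq_ltn_trans (size_polyC_leq1 _) _.
  by case/andP: (norm_exp_bounds E).
have Q0 : Q != 0 by rewrite -size_poly_gt0 szQ.
have := size_points_root Q0 US; rewrite szQ => h; apply: leq_trans (h _) _; last first.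
  by apply: (@leq_mul _ _ 3 2) => //; case/andP: (norm_exp_bounds E).
move=> P /hS [x [y [e xc]]]; exists x, y; split=> //.
rewrite /root /Q hornerD hornerN hornerC hornerZ horner_exp affine_linearE -xc.
by rewrite /norm_x subrr.
Qed.

(* Among the points with u y = 0 there are at most 4 abscissae. *)
Lemma size_special_points (S : seq curve) : uniq S ->
  (forall P, P \in S -> exists x y, val P = Some (x, y) /\ (u x == 0) || (y == 0)) ->
  (size S <= 8)%N.
Proof.
move=> US hS.
pose cub : {poly rat} := Poly [:: wc E; wb E; wa E; 1].
have cub_size : size cub = 4 by rewrite (PolyK (c := 0)) //= oner_neq0.
have szQ : size (affine_linear * cub) = 5.
  by rewrite size_mul -?size_poly_gt0 ?affine_linear_size ?cub_size.
have Q0 : affine_linear * cub != 0 by rewrite -size_poly_gt0 szQ.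
have := size_points_root Q0 US; rewrite szQ; apply.
move=> P /hS [x [y [e bad]]]; exists x, y; split=> //.
rewrite rootM /root affine_linearE horner_Poly /=.
case/orP: bad => [->//|/eqP y0]; apply/orP; right.
have := valP P; rewrite /= e y0 => /eqP e1; apply/eqP.
by transitivity (x ^+ 3 + wa E * x ^+ 2 + wb E * x + wc E);
  [ring | rewrite -e1 expr0n].
Qed.

(** With T = floor(exp B), at most 3 T^2 values of [norm_x] are possible, besides infinity. Each is
    taken by at most 6 points (exponent at most 3, two signs), and 6 (1 + 3 T^2) <= 24 T^2. *)
Lemma size_small_points (S : seq curve) (B : R) : 0 <= B -> uniq S ->
  (forall P, P \in S -> cheight P <= B) -> (size S)%:R <= 24 * expR (2 * B).
Proof.
move=> B0 US hS; pose T := Num.truncn (expR B).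
have T1 : 1 <= expR B by rewrite -expR0 ler_expR.
have leT (x : rat) : height R x <= B -> (mheight x <= T)%N.
  move=> h; rewrite /T truncn_ge_nat ?expR_ge0 // -[X in X <= _](@lnK R).
    by rewrite ler_expR.
  by rewrite posrE ltr0n mheight_gt0.
have T0 : (0 < T)%N by rewrite (leq_trans (mheight_gt0 0)) // leT // height0.
pose rats := rationals_upto T.
have rats_size : (size rats <= 3 * T ^ 2)%N by apply: size_rationals_upto.
pose f (P : curve) : option rat := if val P is Some (x, _) then Some (norm_x E x) else None.
have : (size S <= size (None :: map Some rats) * 6)%N.
  apply: (@size_le_fibers _ _ f).
    move=> P /hS; rewrite /cheight /f in_cons; case: (val P) => [[x y]|] //= h.
    by rewrite mem_map ?mem_rationals_upto ?leT // => ? ? [].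
  move=> [c|]; rewrite -size_filter; last first.
    apply: (@leq_trans (size [:: (0 : curve)])) => //.
    apply: uniq_leq_size; first exact: filter_uniq.
    move=> P; rewrite mem_filter /f inE => /andP[h _].
    by apply/eqP/val_inj; move: h => /=; case: (val P) => [[]|].
  apply: (@norm_x_fiber _ c); first exact: filter_uniq.
  move=> P; rewrite mem_filter /f => /andP[]; case: (val P) => [[x y]|] // /eqP[<-] _.
  by exists x, y.
rewrite /= size_map => le.
have {}le : (size S <= 24 * T ^ 2)%N by apply: leq_trans le _; nia.
have TB : T%:R <= expR B by rewrite /T truncn_le // expR_ge0.
apply: (@le_trans _ _ (24 * T%:R ^+ 2)).
  by rewrite -natrX -natrM ler_nat.
rewrite ler_pM2l // mulrC (expRM_natr 2) lerXn2r // nnegrE ?expR_ge0 //.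
Qed.

End Counting.

(** * Maximal independent families *)

Section Rank.
Variables (R : realType) (E : elliptic_curve).
Local Notation curve := (curve_pt E).

Definition zindependent (r : nat) (g : 'I_r -> curve) :=
  forall k : 'I_r -> int, \sum_i g i *~ k i = 0 -> forall i, k i = 0.

Lemma independentP (r : nat) (g : 'I_r -> curve) :
  @independent E r (fun i => val (g i)) <-> zindependent g.
Proof.
have sumE (k : 'I_r -> int) :
    \big[addp E/None]_(i < r) mulp E (k i) (val (g i)) = val (\sum_i g i *~ k i).
  by rewrite val_curve_sum; apply: eq_bigr => i _; rewrite val_curve_mulz.
split=> ind k e; apply: ind; first by rewrite sumE e.
by apply: val_inj; rewrite -sumE e.
Qed.

(** If independent families are arbitrarily large, the supremum is infinite. Otherwise take one of
    maximal size: adjoining x creates a relation, in which x has a nonzero coefficient since the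
    family is independent. *)
Lemma rank_generators : mw_rank R E = +oo%E \/
  exists (r : nat) (g : 'I_r -> curve), ((r%:R)%:E <= mw_rank R E)%E /\
    forall x, exists n (k : 'I_r -> int), (0 < n)%N /\ x *+ n = \sum_i g i *~ k i.
Proof.
pose A (r : nat) := exists g : 'I_r -> curve, zindependent g.
have leA r : A r -> ((r%:R)%:E <= mw_rank R E)%E.
  case=> g ind; apply: ereal_sup_ubound; exists r => //=.
  by exists (fun i => val (g i)) => [i|]; [apply: valP | apply/independentP].
have A0 : A 0 by exists (fun=> 0) => k _ [].
have [unb|] := pselect (forall n, exists2 r, A r & (n <= r)%N).
  left; apply: eq_infty => s; have [r Ar nr] := unb (Num.bound `|s|).
  apply: le_trans (leA r Ar); rewrite lee_fin; apply: le_trans (ler_norm s) _.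
  by apply: le_trans (ltW (archi_boundP (normr_ge0 s))) _; rewrite ler_nat.
move=> /existsNP[n bnd]; right.
have bd r : `[< A r >] -> (r <= n)%N.
  by move=> /asboolP Ar; apply/ltnW; rewrite ltnNge; apply/negP => nr; apply: bnd; exists r.
have exA : exists r, `[< A r >] by exists 0; apply/asboolP.
case: (ex_maxnP exA bd) => r /asboolP Ar rmax; have [g ind] := Ar.
exists r, g; split=> [|x]; first exact: leA.
pose g' (i : 'I_r.+1) := if insub (val i) is Some j then g j else x.
have g'w i : g' (widen_ord (leqnSn r) i) = g i by rewrite /g' /= valK.
have g'm : g' ord_max = x by rewrite /g' insubF //= ltnn.
have /existsNP[k] : ~ zindependent g'.
  move=> ind'; have /asboolP/rmax : A r.+1 by exists g'.
  by rewrite ltnn.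
move=> /not_implyP[e k0]; move: e; rewrite big_ord_recr /= g'm => /eqP; rewrite addrC addr_eq0 => /eqP e.
have km : k ord_max != 0.
  apply: contra_notN k0 => /eqP km.
  have h : forall i, k (widen_ord (leqnSn r) i) = 0.
    apply: ind; apply/eqP; rewrite -oppr_eq0; move/eqP: e; rewrite km mulr0z eq_sym.
    by under eq_bigr do rewrite g'w.
  move=> i; have [ir|] := ltnP i r; last first.
    move=> ri; have -> : i = ord_max by apply/val_inj/eqP; rewrite eqn_leq -ltnS ltn_ord.
    exact: km.
  by rewrite -(h (Ordinal ir)); congr k; apply: val_inj.
(* The sign of the coefficient of x moves to the other side, as the multiple of x has to be
   positive. *)
exists (absz (k ord_max)), (fun i => - k (widen_ord (leqnSn r) i) * sgz (k ord_max)).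
split; first by rewrite absz_gt0.
rewrite pmulrn abszEsg mulrC mulrzA e -sumrN mulrz_suml.
by apply: eq_bigr => i _; rewrite g'w mulrzA mulrNz.
Qed.

End Rank.

(** * Progressions *)

Section Progression.
Variables (R : realType) (E : elliptic_curve).
Local Notation height := (height R).
Local Notation hj := (hj R E).
Local Notation norm_x := (norm_x E).
Local Notation u := (dep_x E).
Local Notation p := (dep_p E).
Local Notation q := (dep_q E).

(** Dividing u by v and y by z keeps lines straight; the slope becomes l v/z and the curve acquires
    the factor d = z^2/v^3. *)
Lemma chord_scaled x1 y1 x0 y0 l x3 (v z : rat) : chord E x1 y1 x0 y0 l x3 ->
  v != 0 -> z != 0 -> let s := l * v / z in
  [/\ s * (u x0 / v - u x1 / v) = y0 / z - y1 / z,
      u x3 / v = z ^+ 2 / v ^+ 3 * s ^+ 2 - u x0 / v - u x1 / v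
    & (l * (x1 - x3) - y1) / z = s * (u x1 / v - u x3 / v) - y1 / z].
Proof.
move=> c v0 z0 s; have ux := chord_dep_x c; have e0 : y0 = y1 + l * (u x0 - u x1).
  by case: c => -> _ _ _; rewrite /dep_x; ring.
have e1 : x1 - x3 = u x1 - u x3 by rewrite /dep_x; ring.
rewrite e1 {}e0 /s; move: (u x0) (u x1) (u x3) ux => a b c' ->.
by split; field; rewrite ?v0 ?z0.
Qed.

Section Scaled.
Variables (xr yr : rat) (M : R).
Hypothesis on_r : on_curve E (Some (xr, yr)).
Hypothesis ur0 : u xr != 0.
Hypothesis yr0 : yr != 0.
Hypothesis M1 : hj <= M.
Hypothesis hr : height (norm_x xr) <= M.

Let p' := p / u xr ^+ 2.
Let q' := q / u xr ^+ 3.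
Let d := 1 + p' + q'.

Let M_ge1 : 1 <= M. Proof. exact: le_trans (hj_ge1 R E) M1. Qed.

Let hp' : height p' <= 72 * M.
Proof. by have := height_scaled_p R ur0; rewrite -/p'; move: M1 hr; lra. Qed.

Let hq' : height q' <= 73 * M.
Proof. by have := height_scaled_q R ur0; rewrite -/q'; move: M1 hr; lra. Qed.

Let dE : d = yr ^+ 2 / u xr ^+ 3.
Proof.
rewrite /d /p' /q' (on_curve_dep on_r); move: (u xr) ur0 => v v0; by field.
Qed.

Let d0 : d != 0.
Proof. by rewrite dE mulf_neq0 ?invr_eq0 ?expf_neq0. Qed.

Let hd : height d <= 147 * M.
Proof.
have := heightD R (1 + p') q'; have := heightD R 1 p'; rewrite height1 -/d.
by move: hp' hq' M_ge1; lra.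
Qed.

Lemma scaled_curve x y : on_curve E (Some (x, y)) ->
  d * (y / yr) ^+ 2 = (u x / u xr) ^+ 3 + p' * (u x / u xr) + q'.
Proof.
move=> /on_curve_dep e; rewrite dE /p' /q'.
have -> : yr ^+ 2 / u xr ^+ 3 * (y / yr) ^+ 2 = y ^+ 2 / u xr ^+ 3.
  by move: (u xr) ur0 => v v0; field; rewrite v0 yr0.
by rewrite e; move: (u xr) ur0 (u x) => v v0 w; field.
Qed.

Lemma height_scaled_y x y (H : R) : on_curve E (Some (x, y)) -> M <= H ->
  height (u x / u xr) <= H -> height (y / yr) <= 190 * H.
Proof.
move=> on1 MH hx; have e := scaled_curve on1; set xi := u x / u xr in e hx.
have e2 : (y / yr) ^+ 2 = (xi ^+ 3 + p' * xi + q') / d by rewrite -e [RHS]mulrAC divff // mul1r.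
have := heightF R (xi ^+ 3 + p' * xi + q') d; rewrite -e2 heightX.
have := heightD R (xi ^+ 3 + p' * xi) q'; have := heightD R (xi ^+ 3) (p' * xi).
have := heightM R p' xi; rewrite heightX; move: hd hp' hq' M_ge1; lra.
Qed.

(** The scaled abscissa is a root of the monic cubic X^3 + p' X + q' - d eta^2, where eta = y/yr. *)
Lemma height_scaled_x x y (H : R) : on_curve E (Some (x, y)) -> M <= H ->
  height (y / yr) <= H -> height (u x / u xr) <= 400 * H.
Proof.
move=> on1 MH hy; have e := scaled_curve on1; set xi := u x / u xr in e *.
set eta := y / yr in e hy; set cst := q' - d * eta ^+ 2.
pose f : {poly rat} := Poly [:: cst; p'; 0; 1].
have f_size : size f = 4 by rewrite (PolyK (c := 0)) //= oner_neq0.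
have f_monic : f \is monic by rewrite monicE lead_coefE f_size coef_Poly.
have f_root : root f xi.
  rewrite /root horner_Poly /= /cst e; apply/eqP; ring.
have := height_monic_root R f_monic f_root; rewrite f_size /= !big_ord_recl big_ord0 /= !coef_Poly /=.
have := heightB R q' (d * eta ^+ 2); have := heightM R d (eta ^+ 2).
by rewrite -/cst heightX height0; move: hd hp' hq' M_ge1; lra.
Qed.

(* R = (xr, yr) and S = (xs, ys) are the differences of two terms with a third
   one (x0, y0), in a progression; then R has been scaled to (1, 1). *)
Lemma height_center x0 y0 xs ys x2 y2 x3 y3 (k : rat) :
  on_curve E (Some (x0, y0)) -> on_curve E (Some (xs, ys)) ->
  addp E (Some (xr, yr)) (Some (x0, y0)) = Some (x2, y2) ->
  addp E (Some (xs, ys)) (Some (x0, y0)) = Some (x3, y3) ->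
  height (norm_x xs) <= M -> height k <= 2 * M ->
  k * x2 - (k - 1) * x3 = x0 \/ k * y2 - (k - 1) * y3 = y0 ->
  height (u x0 / u xr) <= 1000 * (400 * (380 * M)).
Proof.
move=> on0 on_s ad2 ad3 hs hk prog.
have e0 := scaled_curve on0; have es := scaled_curve on_s.
set xi := u x0 / u xr in e0 *; set eta := y0 / yr in e0.
have ha : height (u xs / u xr) <= 2 * M.
  by have := height_ratio R E xs xr; move: hr hs; lra.
have hb : height (ys / yr) <= 380 * M.
  by have := @height_scaled_y xs ys (2 * M) on_s; move: M_ge1 ha; lra.
set a := u xs / u xr in ha es *; set b := ys / yr in hb es.
(* When xi is 1 or a, the slope is not a quotient of coordinate differences, but xi is bounded
   directly. *)
have [x0r|x0r] := eqVneq xi 1; first by rewrite x0r height1; move: M_ge1; lra.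
have [x0s|x0s] := eqVneq xi a; first by rewrite x0s; move: M_ge1 ha; lra.
have chordE x1 y1 x4 y4 : on_curve E (Some (x1, y1)) -> u x1 / u xr != xi ->
    addp E (Some (x1, y1)) (Some (x0, y0)) = Some (x4, y4) ->
    exists s, [/\ s * (xi - u x1 / u xr) = eta - y1 / yr,
      u x4 / u xr = d * s ^+ 2 - xi - u x1 / u xr &
      y4 / yr = s * (u x1 / u xr - u x4 / u xr) - y1 / yr].
  move=> on1 ne ad.
  have opp : ~~ opposite x1 y1 x0 y0.
    by apply/negP => /andP[/eqP e _]; move: ne; rewrite e eqxx.
  have [l [x5 c]] := chordP on1 on0 opp; move: ad; rewrite (addp_chord opp c) => -[<- <-].
  by exists (l * u xr / yr); rewrite dE; apply: (chord_scaled c).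
have r1 : u xr / u xr = 1 by rewrite divff.
have yr1 : yr / yr = 1 by rewrite divff.
have [s [s1 s2 s3]] : exists s, [/\ s * (xi - u xr / u xr) = eta - yr / yr,
      u x2 / u xr = d * s ^+ 2 - xi - u xr / u xr &
      y2 / yr = s * (u xr / u xr - u x2 / u xr) - yr / yr].
  by apply: chordE ad2; rewrite // r1 eq_sym.
rewrite r1 yr1 in s1 s2 s3.
have [t [t1 t2 t3]] : exists t, [/\ t * (xi - a) = eta - b,
      u x3 / u xr = d * t ^+ 2 - xi - a &
      y3 / yr = t * (a - u x3 / u xr) - b].
  by apply: chordE ad3; rewrite // eq_sym.
have B1 : 1 <= 380 * M by move: M_ge1; lra.
have hpB : height p' <= 380 * M by move: hp' M_ge1; lra.
have hqB : height q' <= 380 * M by move: hq' M_ge1; lra.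
have haB : height a <= 380 * M by move: ha M_ge1; lra.
have hkB : height k <= 380 * M by move: hk M_ge1; lra.
case: prog => prog.
  have ek : k * (u x2 / u xr) - (k - 1) * (u x3 / u xr) = xi.
    have ek0 : k * u x2 - (k - 1) * u x3 = u x0 by rewrite /dep_x -prog; ring.
    by rewrite /xi -ek0 [RHS]mulrBl !mulrA.
  have := @height_of_x_progression R p' q' d (380 * M) erefl B1 hpB hqB
    a b k xi eta s t _ _ haB hb hkB es e0 s1 t1 s2 t2 ek.
  by move: M_ge1; lra.
have ek : k * (s * (1 - u x2 / u xr) - 1) - (k - 1) * (t * (a - u x3 / u xr) - b) = eta.
  by rewrite -s3 -t3 /eta -prog; field.
exact: (@height_of_y_progression R p' q' d (380 * M) erefl B1 hpB hqB
    a b k xi eta s t _ _ haB hb hkB es e0 s1 t1 s2 t2 ek).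
Qed.

End Scaled.
End Progression.

Section ProgressionHeight.
Variables (R : realType) (E : elliptic_curve).
Local Notation height := (height R).
Local Notation hj := (hj R E).
Local Notation u := (dep_x E).
Local Notation curve := (curve_pt E).
Local Notation N := (@cheight R E).

(** From the inside: 1000 * 400 * 380 comes from [height_center], 10 * 1000 passes to a second term,
    and 1600 * 1200 covers interpolation and the return to [norm_x]. *)
Definition prog_const : R := 1600 * (1200 * (10 * (1000 * (1000 * (400 * 380))))).

Lemma height_index n (i j : 'I_n) : height ((i : nat)%:R - (j : nat)%:R) <= ln n%:R.
Proof.
have -> : (i : nat)%:R - (j : nat)%:R = ((i : nat)%:Z - (j : nat)%:Z)%:~R :> rat.
  by rewrite intrB.
rewrite height_int; have := ltn_ord i; have := ltn_ord j => lj li.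
rewrite ler_ln ?posrE ?ltr0n; [|lia|lia].
by rewrite ler_nat; lia.
Qed.

Variables (n : nat) (P : 'I_n -> curve) (x y : 'I_n -> rat) (A D : rat).
Hypothesis PE : forall i, val (P i) = Some (x i, y i).
Hypothesis D0 : D != 0.
Hypothesis prog :
  (forall i : 'I_n, x i = A + (i : nat)%:R * D) \/ (forall i : 'I_n, y i = A + (i : nat)%:R * D).

Lemma progression_inj : injective P.
Proof.
move=> i j e; have := congr1 val e; rewrite !PE => -[ex ey].
have : (i : nat)%:R * D = (j : nat)%:R * D.
  by case: prog => pr; apply: (addrI A); rewrite -!pr.
by move/(mulIf D0)/eqP; rewrite eqr_nat => /eqP; apply: val_inj.
Qed.

(** Two small differences bound the term i0 by [height_center], and then i2 by addition. Two terms
    determine the progression, so every other term is an interpolation with coefficients of height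
    at most 2 log n. *)
Lemma progression_height (M : R) (i0 i2 i3 : 'I_n) (xr yr : rat) :
  i0 != i2 -> i0 != i3 -> i2 != i3 ->
  val (P i2 - P i0) = Some (xr, yr) -> u xr != 0 -> yr != 0 ->
  hj <= M -> ln n%:R <= M -> N (P i2 - P i0) <= M -> N (P i3 - P i0) <= M ->
  forall i, N (P i) <= prog_const * M.
Proof.
move=> n02 n03 n23 Re u0 y0 hM lnM hR hS i.
have M1 : 1 <= M by apply: le_trans (hj_ge1 R E) hM.
have on j : on_curve E (Some (x j, y j)) by rewrite -PE; apply: valP.
have on_r : on_curve E (Some (xr, yr)) by rewrite -Re; apply: valP.
have NE j : N (P j) = height (norm_x E (x j)) by rewrite /cheight PE.
have NR : height (norm_x E xr) <= M by move: hR; rewrite /cheight Re.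
case Se : (val (P i3 - P i0)) => [[xs ys]|]; last first.
  move: n03; rewrite -(inj_eq progression_inj) eq_sym -subr_eq0 => /negP[].
  by apply/eqP/val_inj.
have on_s : on_curve E (Some (xs, ys)) by rewrite -Se; apply: valP.
have NS : height (norm_x E xs) <= M by move: hS; rewrite /cheight Se.
have ad2 : addp E (Some (xr, yr)) (Some (x i0, y i0)) = Some (x i2, y i2).
  by rewrite -Re -!PE -val_curveD subrK.
have ad3 : addp E (Some (xs, ys)) (Some (x i0, y i0)) = Some (x i3, y i3).
  by rewrite -Se -!PE -val_curveD subrK.
have idx (j k : 'I_n) : j != k -> ((j : nat)%:R - (k : nat)%:R : rat) != 0.
  by rewrite subr_eq0 eqr_nat.
have hidx (j k : 'I_n) : height ((j : nat)%:R - (k : nat)%:R) <= M.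
  exact: le_trans (height_index j k) lnM.
(* The weight for which k i2 - (k - 1) i3 = i0 holds among the indices. *)
pose k : rat := ((i3 : nat)%:R - (i0 : nat)%:R) / ((i3 : nat)%:R - (i2 : nat)%:R).
have hk : height k <= 2 * M.
  by apply: le_trans (heightF _ _ _) _; have := hidx i3 i0; have := hidx i3 i2; lra.
have n32 := idx i3 i2; rewrite eq_sym in n32; have {}n32 := n32 n23.
have kz (z : 'I_n -> rat) : (forall j : 'I_n, z j = A + (j : nat)%:R * D) ->
    k * z i2 - (k - 1) * z i3 = z i0.
  by move=> zE; rewrite !zE /k; field.
have prog_k : k * x i2 - (k - 1) * x i3 = x i0 \/ k * y i2 - (k - 1) * y i3 = y i0.
  by case: prog => pr; [left | right]; apply: kz.
have := height_center on_r u0 y0 hM NR (on i0) on_s ad2 ad3 NS hk prog_k.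
set L := 1000 * _ => h0.
have LM : M <= L by rewrite /L; lra.
have N0 : N (P i0) <= 4 * L.
  by rewrite NE; have := height_norm_x R (x i0) u0; lra.
have N2 : N (P i2) <= 84 * (100 * L).
  have := pt_height_add R (valP (P i2 - P i0)) (valP (P i0)).
  rewrite -val_curveD subrK -/(cheight R _) -/(cheight R _) -/(cheight R _).
  by lra.
have [L2 L2E] : {L2 | L2 = 10 * (1000 * L)} by exists (10 * (1000 * L)).
have h2 : height (u (x i2) / u xr) <= L2.
  by have := height_ratio R E (x i2) xr; rewrite -NE L2E; lra.
have {}h0 : height (u (x i0) / u xr) <= L2 by rewrite L2E; lra.
have ML2 : M <= L2 by rewrite L2E; lra.
have L2_ge1 : 1 <= L2 by apply: le_trans ML2.
pose c : rat := ((i : nat)%:R - (i0 : nat)%:R) / ((i2 : nat)%:R - (i0 : nat)%:R).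
have hc : height c <= 2 * M.
  by apply: le_trans (heightF _ _ _) _; have := hidx i i0; have := hidx i2 i0; lra.
have interp (a0 a2 : rat) (H : R) : L2 <= H -> height a0 <= H -> height a2 <= H ->
    height (a0 + c * (a2 - a0)) <= 7 * H.
  move=> H1 ha0 ha2; have := heightD R a0 (c * (a2 - a0)).
  by have := heightM R c (a2 - a0); have := heightB R a2 a0; lra.
have n20 := idx i2 i0; rewrite eq_sym in n20; have {}n20 := n20 n02.
have cz (z : 'I_n -> rat) : (forall j : 'I_n, z j = A + (j : nat)%:R * D) ->
    z i = z i0 + c * (z i2 - z i0).
  by move=> zE; rewrite !zE /c; field.
(* For y-progressions: 190 for passing to ordinates, 7 for interpolating, 400 for returning to
   abscissae. *)
suff hx : height (u (x i) / u xr) <= 400 * (7 * (190 * L2)).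
  have := height_norm_x R (x i) u0; rewrite NE /prog_const.
  by move: hx; rewrite L2E /L; lra.
case: prog => pr.
  have -> : u (x i) / u xr = u (x i0) / u xr + c * (u (x i2) / u xr - u (x i0) / u xr).
    have -> : u (x i) = u (x i0) + c * (u (x i2) - u (x i0)).
      by rewrite /dep_x (cz x pr); ring.
    by rewrite -mulrBl mulrA -mulrDl.
  by have := interp _ _ _ (lexx _) h0 h2; lra.
have hy0 := height_scaled_y on_r u0 y0 hM NR (on i0) ML2 h0.
have hy2 := height_scaled_y on_r u0 y0 hM NR (on i2) ML2 h2.
apply: (height_scaled_x on_r u0 y0 hM NR (on i)); first by lra.
have -> : y i / yr = y i0 / yr + c * (y i2 / yr - y i0 / yr).
  by rewrite (cz y pr) -mulrBl mulrA -mulrDl.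
by apply: interp => //; lra.
Qed.

End ProgressionHeight.

(** * From the length of a progression to the rank *)

Section Main.
Variable R : realType.

Let prog_const_gt0 : 0 < prog_const R. Proof. by rewrite /prog_const; lra. Qed.

Section Ball.
Variables (E : elliptic_curve) (n : nat) (P : 'I_n -> curve_pt E).
Variables (x y : 'I_n -> rat) (A D : rat).
Hypothesis PE : forall i, val (P i) = Some (x i, y i).
Hypothesis D0 : D != 0.
Hypothesis prog :
  (forall i : 'I_n, x i = A + (i : nat)%:R * D) \/ (forall i : 'I_n, y i = A + (i : nat)%:R * D).
Local Notation N := (@cheight R E).
Local Notation hj := (hj R E).

Let S := codom P.

Let S_uniq : uniq S.
Proof. by rewrite map_inj_uniq ?enum_uniq //; apply: progression_inj PE D0 prog. Qed.

Let ball (i0 : 'I_n) (delta : R) := [seq Q <- S | N (Q - P i0) < delta].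

Lemma size_ball_le (i0 : 'I_n) (delta : R) :
  0 < delta -> (size (ball i0 delta))%:R <= 24 * expR (2 * delta).
Proof.
move=> d0; rewrite -(size_map (fun Q => Q - P i0)); apply: size_small_points; first exact: ltW.
  by rewrite map_inj_uniq ?filter_uniq // => ? ? /addIr.
by move=> Q /mapP[Q']; rewrite mem_filter => /andP[/ltW h _] ->.
Qed.

(** Eleven points in the ball give at least ten nonzero differences with P i0. At most eight have u
    y = 0, so some difference can serve as R, and any other one as S. *)
Lemma large_ball_progression_height (i0 : 'I_n) (delta : R) :
  0 < delta -> (10 < size (ball i0 delta))%N ->
  forall i, N (P i) <= prog_const R * (delta + ln n%:R + hj).
Proof.
move=> d0 sz; pose special (Q : curve_pt E) :=
  if val Q is Some (x1, y1) then (dep_x E x1 == 0) || (y1 == 0) else false.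
pose T' := [seq Q - P i0 | Q <- ball i0 delta]; pose T := [seq Q <- T' | Q != 0].
have TU : uniq T'.
  by rewrite map_inj_uniq ?filter_uniq // => ? ? /addIr.
have szT : (10 <= size T)%N.
  have e : count (predC (pred1 0)) T' = size T by rewrite size_filter; apply: eq_count.
  have := count_predC (pred1 0) T'; rewrite e (count_uniq_mem 0 TU) size_map.
  by case: (0 \in T'); move: sz => /=; lia.
have memT Q : Q \in T -> exists i, [/\ Q = P i - P i0, N Q < delta & i != i0].
  rewrite mem_filter => /andP[Q0 /mapP[Q']]; rewrite mem_filter => /andP[h /codomP[i e]] eQ.
  exists i; rewrite eQ e -e; split=> //.
  by apply: contraNneq Q0 => ei; rewrite eQ e ei subrr.
have UT : uniq T by apply: filter_uniq.
have /allPn[R2 R2T ns] : ~~ all special T.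
  apply/negP => /allP sp; have : (size T <= 8)%N; last by move/(leq_trans szT).
  apply: size_special_points UT _ => Q QT; have := sp Q QT; rewrite /special.
  by case: (val Q) => [[x1 y1]|] // ?; exists x1, y1.
have /allPn[R3 R3T /= n23] : ~~ all (pred1 R2) T.
  apply/negP => /allP al; have : (size T <= size [:: R2])%N; last by move/(leq_trans szT).
  by apply: uniq_leq_size => // Q /al /eqP ->; apply: mem_head.
have [i2 [e2 h2 n20]] := memT _ R2T; have [i3 [e3 h3 n30]] := memT _ R3T.
case Re : (val R2) ns => [[xr yr]|]; rewrite /special Re; last first.
  move=> _; move: R2T; rewrite mem_filter => /andP[/eqP[]].
  exact: val_inj.
rewrite negb_or => /andP[u0 y0].
have ln0 : 0 <= ln n%:R :> R.
  by apply: ln_ge0; rewrite ler1n; apply: leq_ltn_trans (ltn_ord i0).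
have hj1 := hj_ge1 R E.
apply: (progression_height PE D0 prog (i0 := i0) (i2 := i2) (i3 := i3) (xr := xr) (yr := yr)) => //.
- by rewrite eq_sym.
- by rewrite eq_sym.
- by apply: contraNneq n23 => e; rewrite e2 e3 e.
- by rewrite -e2.
- by lra.
- by lra.
- by rewrite -e2; lra.
- by rewrite -e3; lra.
Qed.

End Ball.

(** Here 8 c d is the largest height or its imposed floor. The first case gives d <= (l + h)/7, the
    second d <= 1400 h. The point is that l has coefficient at most 1/2 in 2 d, the exponent
    counting a ball. *)
Lemma radius_bound (c d l h : R) : 0 < c -> 0 <= l -> 1 <= h ->
  8 * c * d <= Num.max (c * (d + l + h)) (1400 * h * (8 * c)) -> 2 * d <= l / 2 + 2801 * h.
Proof.
move=> c0 l0 h1; have -> : 8 * c * d = c * (8 * d) by ring.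
have -> : 1400 * h * (8 * c) = c * (8 * (1400 * h)) by ring.
by rewrite le_max !ler_pM2l // => /orP[] le; lra.
Qed.

(** Bounds the left side of [m_large] divided by [delta], for K = 1400, C = 1400 h <= [delta] and
    [rho] = 8 [prog_const] [delta]. Tripling it leaves room for the subtracted C/3. *)
Definition packing_const : R := 1400 * (2 + 1400 * (2 * (8 * prog_const R) + 1)).

Lemma packing_const_large (d h w : R) : 0 < w -> 0 < d -> 1400 * h <= d ->
  3 * packing_const <= w ->
  1400 * d + 1400 * h + 1400 * (2 * 1400 * (8 * prog_const R * d) + 1400 * h)
    <= w * (d - 1400 * h / 3).
Proof.
move=> w0 d0 hd hw.
have h1 : 3 * packing_const * d <= w * d by rewrite ler_pM2r.
have h2 : w * (1400 * h / 3) <= w * (d / 3) by rewrite ler_pM2l //; lra.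
have h3 : 0 < prog_const R * d by rewrite mulr_gt0.
by move: h1 h2; rewrite /packing_const; lra.
Qed.

Lemma third_lt (C d : R) : 0 < C -> C <= d -> C / 3 < d.
Proof. by move=> C0 Cd; lra. Qed.

(** The term l/2 moves to the left and doubles the rest; 1 + 24 + 2801 is rounded up to 2900. *)
Lemma rank_bound (l h r s : R) : 0 <= r -> 0 <= s -> 1 <= h ->
  l <= r * (s + 1) + 24 + (l / 2 + 2801 * h) -> l <= 2 * (s + 2900) * h * (1 + r).
Proof.
move=> r0 s0 h1 le; rewrite -mulrA; set X := h * (1 + r).
have hX : h <= X by apply: ler_peMr; lra.
have rX : r <= X by apply: (@le_trans _ _ (1 * (1 + r))); [lra | apply: ler_wpM2r; lra].
have srX : s * r <= s * X by rewrite ler_wpM2l.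
by lra.
Qed.

(** K is chosen before the curve: it depends only on s, which depends only on [packing_const]. The
    curve enters through [hj] and r alone. *)
Lemma progression_length_le_rank : exists K : nat, (0 < K)%N /\
  forall (E : elliptic_curve) n (P : 'I_n -> curve_pt E) (x y : 'I_n -> rat) (A D : rat)
    (r : nat) (g : 'I_r -> curve_pt E),
  (forall i, val (P i) = Some (x i, y i)) -> D != 0 ->
  (forall i : 'I_n, x i = A + (i : nat)%:R * D) \/ (forall i : 'I_n, y i = A + (i : nat)%:R * D) ->
  (forall Q, exists m (k : 'I_r -> int), (0 < m)%N /\ Q *+ m = \sum_i g i *~ k i) ->
  ln n%:R <= K%:R * hj R E * (1 + r%:R) :> R.
Proof.
have c0_gt0 : 0 <= 3 * packing_const by have := prog_const_gt0; rewrite /packing_const; lra.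
have [s hs] : exists s : nat, 3 * packing_const <= 4 ^+ s.+1 :> R.
  exists (Num.bound (3 * packing_const)); apply: le_trans (ltW (archi_boundP c0_gt0)) _.
  set b := Num.bound _; rewrite -natrX ler_nat.
  by apply: leq_trans (ltnW (ltn_expl b.+1 (isT : 1 < 4)%N)); apply: leqnSn.
have [K [K0 KE]] : exists K : nat, (0 < K)%N /\ K%:R = 2 * (s%:R + 2900) :> R.
  by exists (2 * (s + 2900))%N; rewrite muln_gt0 addn_gt0 orbT natrM natrD.
exists K; split=> // E n P x y A D r g PE D0 prog rk; rewrite {}KE {K K0}.
have hj1 := hj_ge1 R E; set h := hj R E in hj1 *; set l := ln n%:R.
have [n0|n0] := posnP n.
  rewrite /l n0 (ln0 (lexx 0)); apply: mulr_ge0; last by rewrite addr_ge0 ?ler0n.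
  apply: mulr_ge0; last exact: le_trans hj1.
  by apply: mulr_ge0; [apply: ler0n | apply: addr_ge0; apply: ler0n].
have l0 : 0 <= l by apply: ln_ge0; rewrite ler1n.
have c_gt0 := prog_const_gt0.
have c8_gt0 : 0 < 8 * prog_const R by rewrite mulr_gt0.
pose rhom := \big[Num.max/0]_(i < n) cheight R (P i).
(* The floor guarantees [delta] >= C = 1400 h, hence C/3 < [delta], even if all heights are
   small. *)
pose rho := Num.max rhom (1400 * h * (8 * prog_const R)).
have [delta rhoE] : exists delta, rho = 8 * prog_const R * delta.
  by exists (rho / (8 * prog_const R)); rewrite mulrC divfK // gt_eqF.
have h0 : 0 < h by apply: lt_le_trans hj1.
have C_gt0 : 0 < 1400 * h by apply: mulr_gt0 h0; rewrite ltr0n.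
have dh : 1400 * h <= delta.
  by rewrite -(ler_pM2l c8_gt0) -rhoE mulrC /rho le_max lexx orbT.
have d0 : 0 < delta.
  exact: lt_le_trans C_gt0 dh.
pose B := 24 * expR (l / 2 + 2801 * h); pose L := Num.truncn B.
have B24 : 24 <= B.
  rewrite /B ler_peMr // -[leLHS](@expR0 R) ler_expR; apply: addr_ge0.
    exact: divr_ge0 l0 (ler0n _ _).
  exact: mulr_ge0 (ler0n _ _) (ltW h0).
have B0 : 0 <= B by apply: le_trans B24.
have ballL i0 : (count (fun Q => (cheight R (Q - P i0) < delta)%R) (codom P) <= L)%N.
  rewrite -size_filter.
  (* A ball of at most 10 points is within L because B >= 24; a larger one bounds every height,
     hence [delta], by log n. *)
  have [small|large] := leqP (size [seq Q <- codom P | cheight R (Q - P i0) < delta]) 10.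
    apply: leq_trans small _; rewrite /L truncn_ge_nat //; apply: le_trans B24.
    by rewrite ler_nat.
  have hP := large_ball_progression_height PE D0 prog d0 large.
  rewrite /L truncn_ge_nat //; apply: le_trans (size_ball_le PE D0 prog i0 d0) _.
  rewrite /B ler_pM2l // ler_expR; apply: (radius_bound c_gt0) => //.
  rewrite -rhoE /rho ge_max !le_max lexx orbT andbT; apply/orP; left.
  apply: bigmax_le => [|i _]; last exact: hP.
  apply: mulr_ge0; first exact: ltW.
  by do 2!(apply: addr_ge0 => //; try exact: ltW); apply: le_trans hj1.
have C0 := ltW C_gt0; have hC := third_lt C_gt0 dh.
have K1 : 1 <= 1400 :> R by rewrite ler1n.
have w0 : 0 < 4 ^+ s.+1 :> R by rewrite exprn_gt0.
have N0 Q : 0 <= @cheight R E Q by apply: pt_height_ge0.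
have NN Q : @cheight R E (- Q) = cheight R Q by rewrite /cheight val_curveN pt_height_neg.
have NB Q Q' : cheight R (Q - Q') <= 1400 * (cheight R Q + @cheight R E Q') + 1400 * h.
  have := pt_height_add R (valP Q) (valP (- Q')).
  by rewrite -val_curveD val_curveN pt_height_neg -/h /cheight mulrDr.
have N2 Q : 4 * cheight R Q - 1400 * h <= @cheight R E (Q *+ 2).
  have := pt_height_double R (valP Q); rewrite mulr2n -val_curveD -/h /cheight => le.
  rewrite lerBlDr; apply: le_trans le _; rewrite lerD2l.
  by apply: ler_wpM2r; [exact: ltW | rewrite ler_nat].
have ml : 1400 * delta + 1400 * h + 1400 * (2 * 1400 * rho + 1400 * h)
    <= 4 ^+ s.+1 * (delta - 1400 * h / 3).
  by rewrite rhoE; apply: packing_const_large.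
have inball Q : Q \in codom P -> cheight R Q <= rho.
  move=> /codomP[i ->]; rewrite /rho le_max; apply/orP; left.
  exact: le_bigmax.
have balls Q : Q \in codom P ->
    (count (fun x => (cheight R (x - Q) < delta)%R) (codom P) <= L)%N.
  by move=> /codomP[i0 ->]; apply: ballL.
have := size_le_balls K1 C0 N0 (erefl _) NN NB N2 rk d0 hC ml inball balls.
rewrite size_codom card_ord => le.
have LB : L%:R <= B by rewrite /L truncn_le.
have {}le : n%:R <= (2 ^+ s.+1) ^+ r * B :> R.
  apply: (@le_trans _ _ ((2 ^ s.+1) ^ r * L)%N%:R); first by rewrite ler_nat.
  by rewrite natrM !natrX ler_pM2l // !exprn_gt0.
have B_gt0 : 0 < B by apply: lt_le_trans B24.
apply: rank_bound => //.
apply: (@le_trans _ _ (ln ((2 ^+ s.+1) ^+ r * B))).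
  by rewrite /l ler_ln // posrE ?ltr0n // mulr_gt0 ?exprn_gt0.
rewrite lnM ?posrE ?exprn_gt0 // -addrA lerD //.
  by rewrite -exprM mulnC natr1 -natrM; apply: ln_pow2_le.
rewrite /B lnM ?posrE ?expR_gt0 // expRK lerD2r.
by apply: ltW; apply: ln_sublinear.
Qed.

End Main.

(** A change of equation acts affinely on each coordinate, so the progression can be read on E
    itself. *)
Lemma progression_of_nontrivial (coord : rat * rat -> rat) (E : elliptic_curve)
    (n : nat) (Q : 'I_n -> rat * rat) :
  coord = fst \/ coord = snd -> nontrivial_progression coord E Q ->
  exists (P : 'I_n -> curve_pt E) (x y : 'I_n -> rat) (A D : rat),
    [/\ forall i, val (P i) = Some (x i, y i), D != 0 &
      (forall i : 'I_n, x i = A + (i : nat)%:R * D) \/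
      (forall i : 'I_n, y i = A + (i : nat)%:R * D)].
Proof.
move=> co [on [E' [v [r [[v0 _ _ _] [a [d zE]] [i [j nij]]]]]]].
have d0 : d != 0.
  by apply: contraNneq nij => d0; rewrite !zE d0 !mulr0.
exists (fun i => exist _ (Some (Q i)) (on i)), (fun i => (Q i).1), (fun i => (Q i).2).
case: co zE => -> zE.
  exists (v ^+ 2 * a + r), (v ^+ 2 * d); split; first by move=> k /=; case: (Q k).
    by rewrite mulf_neq0 ?expf_neq0.
  left=> k; have /= := zE k => e.
  have -> : (Q k).1 = v ^+ 2 * (((Q k).1 - r) / v ^+ 2) + r by field.
  by rewrite e; ring.
exists (v ^+ 3 * a), (v ^+ 3 * d); split; first by move=> k /=; case: (Q k).
  by rewrite mulf_neq0 ?expf_neq0.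
right=> k; have /= := zE k => e.
have -> : (Q k).2 = v ^+ 3 * ((Q k).2 / v ^+ 3) by field.
by rewrite e; ring.
Qed.

Lemma mheight_max (R : realType) (t : rat) :
  (mheight t)%:R = Num.max (Num.max (numq t)%:~R (- (numq t)%:~R)) (denq t)%:~R :> R.
Proof.
have -> : Num.max (numq t)%:~R (- (numq t)%:~R) = (absz (numq t))%:R :> R.
  by rewrite natr_absz intr_norm maxrN.
have -> : (denq t)%:~R = (absz (denq t))%:R :> R by rewrite natr_absz normr_denq.
rewrite /mheight; case: (leqP (absz (numq t)) (absz (denq t))) => h.
  by rewrite max_r // ler_nat.
by rewrite max_l // ler_nat ltnW.
Qed.

Theorem theorem1p1 (R : realType) :
  exists2 c : rat -> R, closed_formula c &
    forall j0 : rat,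
      0 < c j0 /\
      forall E : elliptic_curve, j_invariant E = j0 ->
        ((c j0)%:E * lne (maxe (beta_x R E) (beta_y R E))
           <= 1 + mw_rank R E)%E.
Proof.
have [K [K0 hK]] := progression_length_le_rank R.
have KR0 : 0 < K%:R :> R by rewrite ltr0n.
have c_gt0 t : 0 < K%:R * (1 + height R t).
  by rewrite mulr_gt0 // ltr_pwDl // height_ge0.
exists (fun t => (K%:R * (1 + height R t))^-1).
  apply: cf_inv; last by move=> t; rewrite gt_eqF.
  have constE (k : nat) : closed_formula (fun=> k%:R : R).
    have -> : (fun=> k%:R : R) = (fun _ : rat => ratr k%:R).
      by apply/funext => t; rewrite ratr_nat.
    exact: cf_const.
  apply: cf_mul; first exact: constE.
  apply: cf_add; first exact: (constE 1).
  (* Absolute values are not among the closed formulas and are written as max(n, -n). *)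
  have -> : height R = (fun t => ln (Num.max (Num.max (numq t)%:~R (- (numq t)%:~R))
      (denq t)%:~R)).
    by apply/funext => t; rewrite /height mheight_max.
  apply: cf_ln; last by move=> t; rewrite lt_max ltr0z denq_gt0 orbT.
  apply: cf_max; last exact: cf_den.
  by apply: cf_max; [exact: cf_num | apply: cf_opp; exact: cf_num].
move=> j0; split; first by rewrite invr_gt0.
move=> E jE; set c := _^-1; have c0 : 0 < c by rewrite invr_gt0.
case: (rank_generators R E) => [-> | [r [g [rle gen]]]]; first by rewrite addey // leey.
pose b := K%:R * (1 + height R j0) * (1 + r%:R).
have beta_le coord : coord = fst \/ coord = snd -> (beta R coord E <= (expR b)%:E)%E.
  move=> co; apply: ge_ereal_sup => _ /= [n [Q ntQ] <-]; rewrite lee_fin.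
  have [P [x [y [A [D [PE D0 pr]]]]]] := progression_of_nontrivial co ntQ.
  have [->|n0] := posnP n; first exact: expR_ge0.
  rewrite -[leLHS]lnK ?posrE ?ltr0n // ler_expR.
  by have := hK E n P x y A D r g PE D0 pr gen; rewrite /hj jE.
have max_le : (maxe (beta_x R E) (beta_y R E) <= (expR b)%:E)%E.
  by rewrite ge_max; apply/andP; split; apply: beta_le; [left | right].
(* In the absence of progressions the maximum is -oo; at values <= 0 the extended logarithm is -oo,
   and the inequality is trivial. *)
have [neg|pos] := leP (maxe (beta_x R E) (beta_y R E)) 0%E.
  by rewrite le0_lneNy // gt0_muleNy ?lte_fin // leNye.
apply: (@le_trans _ _ (c%:E * b%:E)%E).
  have -> : b%:E = lne (expR b)%:E by rewrite lne_EFin ?expR_gt0 // expRK.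
  rewrite lee_pmul2l ?lte_fin // lee_lne // in_itv /= leey andbT; first exact: ltW.
  by rewrite lee_fin expR_ge0.
rewrite -EFinM /b mulrA mulVf ?gt_eqF // mul1r EFinD.
by rewrite leeD2l.
Qed.
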